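(* Let $r\ge1$ and let $n_1,\ldots,n_r$ be integers with $n_1,\ldots,n_{r-1}\ge1$ and $n_r\ge2$. Then the multizeta bi-arrangement $\mathscr{Z}(n_1,\ldots,n_r)$ is $\lambda$-tame, hence $\lambda$-exact.
   Context: Multizeta bi-arrangement. Let $n=n_1+\cdots+n_r$ and $(a_1,\ldots,a_n)=(\underbrace{1,0,\ldots,0}_{n_1},\ldots,\underbrace{1,0,\ldots,0}_{n_r})$. In $\mathbb{P}^n(\mathbb{C})$ with projective coordinates $(z_0,\ldots,z_n)$ let $\mathcal{L}=\{L_0,\ldots,L_n\}$ with $L_0=\{z_0=0\}$, $L_k=\{z_k=a_kz_0\}$ for $1\le k\le n$, and $\mathcal{M}=\{M_0,\ldots,M_n\}$ with $M_0=\{z_1=0\}$, $M_k=\{z_k=z_{k+1}\}$ for $1\le k\le n-1$, $M_n=\{z_n=z_0\}$. We also regard these as linear hyperplanes in $\mathbb{C}^{n+1}$; strata of the projective arrangement correspond to the strata $\ne0$ in $\mathbb{C}^{n+1}$. $\mathscr{Z}(n_1,\ldots,n_r)$ is the projective bi-arrangement $(\mathcal{L},\mathcal{M},\chi)$, where the partial coloring $\chi$ (of strict strata $\neq0$) is $\mu$ on all strata that are intersections of elements of $\mathcal{M}$, and $\lambda$ on all other strict strata. $\lambda$-tame / $\lambda$-exact. Let $\mathcal{B}_\lambda$ be $(\mathcal{L},\mathcal{M},\chi)$ in $\mathbb{C}^{n+1}$ with the coloring completed by $\chi(0)=\lambda$. The projective bi-arrangement is $\lambda$-tame (resp. $\lambda$-exact)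 if $\mathcal{B}_\lambda$ is a well-defined bi-arrangement (i.e. satisfies the Künneth condition below) and is tame (resp. exact). Bi-arrangements in $\mathbb{C}^N$. Let $\mathcal{L},\mathcal{M}$ be disjoint finite sets of linear hyperplanes of $\mathbb{C}^N$. A stratum is an intersection of some of them ($\mathbb{C}^N$ being the empty one); strata $\neq\mathbb{C}^N$ are strict. With $S^\perp$ the space of linear forms vanishing on $S$, a decomposition $S=S_1\pitchfork\cdots\pitchfork S_r$ is an expression of $S$ as an intersection of strata with $S^\perp=\bigoplus_kS_k^\perp$ and every hyperplane of $\mathcal{L}\cup\mathcal{M}$ containing $S$ containing some $S_k$; it is non-trivial if all $S_k$ are strict. A bi-arrangement $(\mathcal{L},\mathcal{M},\chi)$ is given by a coloring $\chi$ of strict strata by $\{\lambda,\mu\}$, equal to $\lambda$ on $\mathcal{L}$ and $\mu$ on $\mathcal{M}$, such that for every non-trivial decomposition $S=S'\pitchfork S''$, $\chi(S)\in\{\chi(S'),\chi(S'')\}$ (Künneth condition). Tame. Put $L_I=\bigcap_{i\in I}L_i$, $M_J=\bigcap_{j\in J}M_j$. A pair $(I,J)$ is dependent if the linear forms defining $L_i$ ($i\in I$), $M_j$ ($j\in J$) are linearly dependent; a circuit is a minimal dependent pair. A strict stratum $S$ is tame if either $\chi(S)=\lambda$ and there is $L_i\supset S$ such that $i$ belongs to no circuit $(I,J)$ with $S\subset L_I\cap M_J$, $\chi(L_I\cap M_J)=\mu$; or $\chi(S)=\mu$ and there is $M_j\supset S$ such that $j$ belongs to no circuit $(I,J)$ with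 $S\subset L_I\cap M_J$, $\chi(L_I\cap M_J)=\lambda$. The bi-arrangement is tame if all strict strata are tame. Exact. Write $S\stackrel{c}{\hookrightarrow}T$ for an inclusion of strata of codimension $c$. A bi-complex is a family $C_{i,j}$ with commuting square-zero differentials $d':C_{i,j}\to C_{i-1,j}$, $d'':C_{i,j-1}\to C_{i,j}$. The Orlik--Solomon bi-complex is the datum, unique up to unique isomorphism, of finite-dimensional $\mathbb{Q}$-vector spaces $A_{i,j}^S$ ($i,j\ge0$, $\operatorname{codim}S=i+j$) and of maps $d'_{S,T}:A_{i,j}^S\to A_{i-1,j}^T$, $d''_{S,T}:A_{i,j-1}^T\to A_{i,j}^S$ for $S\stackrel{1}{\hookrightarrow}T$, such that $A_{0,0}^{\mathbb{C}^N}=\mathbb{Q}$; for every stratum $\Sigma$, $\bigoplus_{S\supset\Sigma}A^S_{\bullet,\bullet}$ is a bi-complex; for every strict $\Sigma$ of codimension $i+j$, if $\chi(\Sigma)=\lambda$ then $0\to A_{i,j}^\Sigma\xrightarrow{d'}\bigoplus_{\Sigma\stackrel{1}{\hookrightarrow}S}A_{i-1,j}^S\xrightarrow{d'}\bigoplus_{\Sigma\stackrel{2}{\hookrightarrow}T}A_{i-2,j}^T$ is exact, and if $\chi(\Sigma)=\mu$ then $\bigoplus_{\Sigma\stackrel{2}{\hookrightarrow}T}A_{i,j-2}^T\xrightarrow{d''}\bigoplus_{\Sigma\stackrel{1}{\hookrightarrow}S}A_{i,j-1}^S\xrightarrow{d''}A_{i,j}^\Sigma\to0$ is exact. The bi-arrangement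 is exact if for every strict $\Sigma$ and all $i+j=\operatorname{codim}\Sigma$: when $\chi(\Sigma)=\lambda$ the full row $0\to A_{i,j}^\Sigma\to\bigoplus_{\Sigma\stackrel{1}{\hookrightarrow}S}A_{i-1,j}^S\to\cdots\to\bigoplus_{\Sigma\stackrel{i}{\hookrightarrow}Z}A_{0,j}^Z\to0$ is exact, and when $\chi(\Sigma)=\mu$ the full column $0\to\bigoplus_{\Sigma\stackrel{j}{\hookrightarrow}Z}A_{i,0}^Z\to\cdots\to\bigoplus_{\Sigma\stackrel{1}{\hookrightarrow}S}A_{i,j-1}^S\to A_{i,j}^\Sigma\to0$ is exact. *)

(* Defs.v *)
From HB Require Import structures.
From mathcomp Require Import all_boot all_order all_algebra.
From mathcomp Require Import reals complex.
Set Implicit Arguments.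
Unset Strict Implicit.
Unset Printing Implicit Defensive.
Import GRing.Theory.
Local Open Scope ring_scope.

Inductive color := Lambda | Mu.

Section BiArrangement.

(* The two families of hyperplanes are given by linear forms on V; the sets of
   hyperplanes are the kernels of these forms. *)
Variables (K : fieldType) (V : vectType K) (I J : finType).
Variables (L : I -> 'Hom(V, K^o)) (M : J -> 'Hom(V, K^o)).

Definition interL (A : {set I}) : {vspace V} :=
  (\bigcap_(i in A) lker (L i))%VS.
Definition interM (B : {set J}) : {vspace V} :=
  (\bigcap_(j in B) lker (M j))%VS.
Definition inter (A : {set I}) (B : {set J}) : {vspace V} :=
  (interL A :&: interM B)%VS.

Definition strata : seq {vspace V} :=
  [seq inter AB.1 AB.2 | AB : {set I} * {set J}].

(* A finType, so that one can sum over strata. *)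
Definition stratum : Type := seq_sub strata.
HB.instance Definition _ := Finite.on stratum.
Definition stratum_space (S : stratum) : {vspace V} := ssval S.
Local Coercion stratum_space : stratum >-> space.

Definition codim (S : {vspace V}) : nat := (\dim {:V} - \dim S)%N.

Definition strict (S : {vspace V}) : bool := S != fullv.

(* [codim1_incl S T] is the inclusion of S in T in codimension 1. *)
Definition codim1_incl (S T : {vspace V}) : bool :=
  (S <= T)%VS && (codim S == (codim T).+1).

(* S^\perp, the space of linear forms vanishing on S; see [annP]. *)
Definition ann (S : {vspace V}) : {vspace 'Hom(V, K^o)} :=
  (\bigcap_(k < \dim S)
     lker (linfun (fun f : 'Hom(V, K^o) => f (vbasis S)`_k)))%VS.

Lemma annP (S : {vspace V}) (f : 'Hom(V, K^o)) :
  reflect (forall v, v \in S -> f v = 0) (f \in ann S).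
Proof.
have evE v (g : 'Hom(V, K^o)) :
    linfun (fun f : 'Hom(V, K^o) => f v) g = g v.
  pose ev (h : 'Hom(V, K^o)) : K^o := h v.
  have ev_lin : linear ev.
    by move=> a x y; rewrite /ev add_lfunE scale_lfunE.
  pose evL := GRing.isLinear.Build _ _ _ _ ev ev_lin.
  pose ev' : {linear 'Hom(V, K^o) -> K^o} := HB.pack ev evL.
  exact: (lfunE ev' g).
rewrite memvE; apply: (iffP subv_bigcapP) => [fS v vS | fS k _].
  rewrite (coord_vbasis vS) linear_sum big1 // => k _.
  have := fS k isT; rewrite -memvE memv_ker evE => /eqP fk.
  by rewrite linearZ /= fk scaler0.
rewrite -memvE memv_ker evE; apply/eqP/fS.
by rewrite vbasis_mem // mem_nth // size_tuple.
Qed.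

(* S = S1 \pitchfork S2. *)
Definition decomposition (S S1 S2 : stratum) : Prop :=
  [/\ stratum_space S = (S1 :&: S2)%VS,
      ann S = (ann S1 + ann S2)%VS /\ directv (ann S1 + ann S2),
      (forall i, (S <= lker (L i))%VS ->
         (S1 <= lker (L i))%VS \/ (S2 <= lker (L i))%VS) &
      (forall j, (S <= lker (M j))%VS ->
         (S1 <= lker (M j))%VS \/ (S2 <= lker (M j))%VS)].

(* Only the values of a coloring at strict strata matter. *)
Implicit Type chi : {vspace V} -> color.

Definition kunneth chi : Prop :=
  forall S S1 S2 : stratum, decomposition S S1 S2 -> strict S1 -> strict S2 ->
    chi S = chi S1 \/ chi S = chi S2.

Definition is_bi_arrangement chi : Prop :=
  [/\ (forall i, L i != 0) /\ (forall j, M j != 0),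
      [/\ injective (fun i => lker (L i)), injective (fun j => lker (M j)) &
          forall i j, lker (L i) <> lker (M j)],
      (forall i, chi (lker (L i)) = Lambda),
      (forall j, chi (lker (M j)) = Mu) &
      kunneth chi].

Definition dependent (A : {set I}) (B : {set J}) : bool :=
  ~~ free ([seq L i | i in A] ++ [seq M j | j in B]).

Definition circuit (A : {set I}) (B : {set J}) : Prop :=
  dependent A B /\
  forall (A' : {set I}) (B' : {set J}), A' \subset A -> B' \subset B ->
    dependent A' B' -> A' = A /\ B' = B.

Definition tame_stratum chi (S : stratum) : Prop :=
  (chi S = Lambda /\
   exists2 i, (S <= lker (L i))%VS &
     forall A B, circuit A B -> (S <= inter A B)%VS -> chi (inter A B) = Mu ->
       i \notin A)
  \/
  (chi S = Mu /\
   exists2 j, (S <= lker (M j))%VS &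
     forall A B, circuit A B -> (S <= inter A B)%VS ->
       chi (inter A B) = Lambda -> j \notin B).

Definition tame chi : Prop :=
  forall S : stratum, strict S -> tame_stratum chi S.

(* The spaces A_{i,j}^S with maps d'_{S,T} and d''_{S,T}. Only the spaces with
   codim S = i + j and the maps with [codim1_incl S T] are meaningful; nothing
   is required of, and nothing below depends on, the other ones. *)
Record os_data : Type := OSData {
  os_space : nat -> nat -> stratum -> vectType rat;
  os_d1 : forall i j S T, 'Hom(os_space i.+1 j S, os_space i j T);
  os_d2 : forall i j S T, 'Hom(os_space i j T, os_space i j.+1 S)
}.

Section Bicomplex.

Variable A : os_data.

(* An element of the direct sum of the A_{i,j}^S over the strata S containing
   Sigma with codim S = i + j is represented by a family indexed by all strata,
   of which only the components at such S are used. *)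
Definition family (i j : nat) : Type := forall S : stratum, os_space A i j S.

Definition in_range (Sigma : stratum) (c : nat) (S : stratum) : bool :=
  (Sigma <= S)%VS && (codim S == c).

Definition eq_family (Sigma : stratum) i j (x y : family i j) : Prop :=
  forall S, in_range Sigma (i + j) S -> x S = y S.

Definition zero_family i j : family i j := fun S => 0.

Definition d1 (Sigma : stratum) i j (x : family i.+1 j) : family i j :=
  fun T => \sum_(S : stratum | (Sigma <= S)%VS && codim1_incl S T)
             os_d1 A i j S T (x S).

Definition d2 (Sigma : stratum) i j (x : family i j) : family i j.+1 :=
  fun S => \sum_(T : stratum | (Sigma <= T)%VS && codim1_incl S T)
             os_d2 A i j S T (x T).

Definition is_bicomplex (Sigma : stratum) : Prop :=
  [/\ forall i j (x : family i.+2 j),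
        eq_family Sigma (d1 Sigma (d1 Sigma x)) (zero_family i j),
      forall i j (x : family i j),
        eq_family Sigma (d2 Sigma (d2 Sigma x)) (zero_family i j.+2) &
      forall i j (x : family i.+1 j),
        eq_family Sigma (d1 Sigma (d2 Sigma x)) (d2 Sigma (d1 Sigma x))].

Definition d1_cycle (Sigma : stratum) i j : family i j -> Prop :=
  match i with
  | 0 => fun _ => True
  | i'.+1 => fun x => eq_family Sigma (d1 Sigma x) (zero_family i' j)
  end.

Definition d1_boundary (Sigma : stratum) i j (x : family i j) : Prop :=
  exists y : family i.+1 j, eq_family Sigma x (d1 Sigma y).

Definition d2_cycle (Sigma : stratum) i j (x : family i j) : Prop :=
  eq_family Sigma (d2 Sigma x) (zero_family i j.+1).

Definition d2_boundary (Sigma : stratum) i j : family i j -> Prop :=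
  match j with
  | 0 => fun x => eq_family Sigma x (zero_family i 0)
  | j'.+1 => fun x => exists y : family i j', eq_family Sigma x (d2 Sigma y)
  end.

(* No stratum containing Sigma has codimension > codim Sigma, so that when
   codim Sigma = i + j the direct sums beyond A_{i,j}^Sigma are empty: exactness
   at (i, j) of the row (resp. column) is injectivity (resp. surjectivity) of
   the map from (resp. to) A_{i,j}^Sigma. *)
Definition row_exact_at (Sigma : stratum) i j : Prop :=
  forall x : family i j, d1_cycle Sigma x <-> d1_boundary Sigma x.

Definition col_exact_at (Sigma : stratum) i j : Prop :=
  forall x : family i j, d2_cycle Sigma x <-> d2_boundary Sigma x.

Definition is_orlik_solomon chi : Prop :=
  [/\ forall S : stratum, stratum_space S = fullv ->
        exists f : 'Hom(os_space A 0 0 S, rat^o), bijective f,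
      forall Sigma : stratum, is_bicomplex Sigma,
      forall (Sigma : stratum) i j, strict Sigma -> codim Sigma = (i + j)%N ->
        chi Sigma = Lambda ->
        forall a, (a <= i <= a.+1)%N -> row_exact_at Sigma a j &
      forall (Sigma : stratum) i j, strict Sigma -> codim Sigma = (i + j)%N ->
        chi Sigma = Mu ->
        forall b, (b <= j <= b.+1)%N -> col_exact_at Sigma i b].

Definition has_exact_rows_and_columns chi : Prop :=
  forall (Sigma : stratum) i j, strict Sigma -> codim Sigma = (i + j)%N ->
    (chi Sigma = Lambda -> forall a, (a <= i)%N -> row_exact_at Sigma a j) /\
    (chi Sigma = Mu -> forall b, (b <= j)%N -> col_exact_at Sigma i b).

End Bicomplex.

(* The Orlik-Solomon bi-complex is unique up to unique isomorphism, so that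
   requiring exactness of one or of all of its models is the same. *)
Definition exact chi : Prop :=
  exists A : os_data,
    is_orlik_solomon A chi /\ has_exact_rows_and_columns A chi.

(* The projective bi-arrangement (L, M, chi) in P(V), with the color [c] given
   to the stratum 0 of V. *)
Definition complete_color (c : color) chi : {vspace V} -> color :=
  fun S => if S == 0%VS then c else chi S.

Definition lambda_tame chi : Prop :=
  is_bi_arrangement (complete_color Lambda chi) /\
  tame (complete_color Lambda chi).

Definition lambda_exact chi : Prop :=
  is_bi_arrangement (complete_color Lambda chi) /\
  exact (complete_color Lambda chi).

End BiArrangement.

Section Multizeta.

Variables (K : fieldType) (ns : seq nat).

Let n := sumn ns.

(* a_k is [nth 0 multizeta_word k.-1], for 1 <= k <= n. *)
Definition multizeta_word : seq nat :=
  flatten [seq 1%N :: nseq m.-1 0%N | m <- ns].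

(* The coordinate z_k on K^(n+1), for k <= n. *)
Definition zcoord (k : nat) : 'Hom('rV[K]_n.+1, K^o) :=
  linfun (fun v : 'rV[K]_n.+1 => v ord0 (inord k) : K^o).

Lemma zcoordE k v : zcoord k v = v ord0 (inord k).
Proof.
pose ev (w : 'rV[K]_n.+1) : K^o := w ord0 (inord k).
have ev_lin : linear ev by move=> a x y; rewrite /ev !mxE.
pose evL := GRing.isLinear.Build _ _ _ _ ev ev_lin.
pose ev' : {linear 'rV[K]_n.+1 -> K^o} := HB.pack ev evL.
exact: (lfunE ev' v).
Qed.

Definition multizeta_L (k : 'I_n.+1) : 'Hom('rV[K]_n.+1, K^o) :=
  if k == 0%N :> nat then zcoord 0
  else zcoord k - (nth 0%N multizeta_word k.-1)%:R *: zcoord 0.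

Definition multizeta_M (k : 'I_n.+1) : 'Hom('rV[K]_n.+1, K^o) :=
  if k == 0%N :> nat then zcoord 1
  else if k == n :> nat then zcoord n - zcoord 0
  else zcoord k - zcoord k.+1.

Definition multizeta_color (S : {vspace 'rV[K]_n.+1}) : color :=
  if [exists B : {set 'I_n.+1}, S == interM multizeta_M B] then Mu else Lambda.

End Multizeta.

Arguments multizeta_L K ns k : clear implicits.
Arguments multizeta_M K ns k : clear implicits.
Arguments multizeta_color K ns S : clear implicits.

(* Main.v *)
From HB Require Import structures.
Require Import Defs.
From mathcomp Require Import all_boot all_order all_algebra.
From mathcomp Require Import reals complex.
From mathcomp Require Import boolp zify.
Set Implicit Arguments.
Unset Strict Implicit.
Unset Printing Implicit Defensive.
Import GRing.Theory.
Local Open Scope ring_scope.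

(* The Orlik-Solomon bi-complex is built by induction on the codimension of the
   strata, A^S being the kernel of d' if S has color lambda and the cokernel of
   d'' if S has color mu.

   Let L_i contain S and suppose that all strata P between S and L_i have color
   lambda. By induction on codim P, the components of d' at the strata not
   contained in L_i form an isomorphism from A^P to the sum of the A^Q, where P
   has codimension 1 in Q and Q is not in L_i; this makes the rows of S exact.
   Dually, the columns of S are exact if there is M_j containing S such that the
   sum of the A^Q, Q not in M_j, is isomorphic to A^P by d'' for all P between S
   and M_j. This is dual if P has color mu. If P has color lambda, but some L_i
   as above for P is in another connected component than M_j of the arrangement
   of the hyperplanes containing P, then the isomorphisms for d' reduce the
   statement to strata of smaller codimension.

   In the coordinates 0, z_1, ..., z_n, z_0, the elements of M equate
   consecutive coordinates, and those of L compare a coordinate with the last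
   one. A stratum S <> 0 of color lambda is not the intersection of the elements
   of M containing it, so some L_i contains the former but not the latter; for
   S = 0 one takes L_0, as no proper intersection of elements of M is in L_0.
   For S of color mu one takes for M_j an end of the chain if it contains S; the
   hyperplanes containing P then involve either only the coordinates in the
   block of that end, or none of them. If no end contains S, then no L_i does,
   and the strata containing S have color mu. *)

(** * Existence of the Orlik-Solomon bi-complex *)

Lemma linear_hom (K : fieldType) (V1 V2 : vectType K) (f : V1 -> V2) :
  linear f -> exists g : 'Hom(V1, V2), g =1 f.
Proof.
move=> f_lin.
pose fL := GRing.isLinear.Build _ _ _ _ f f_lin.
pose f' : {linear V1 -> V2} := HB.pack f fL.
by exists (linfun f') => v; rewrite (lfunE f').
Qed.

(** Start from a subspace on which [P] holds and add a vector of [P] outside it as long as there is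
    one. The codimension drops each time, so this stops. *)
Lemma linear_vspace (K : fieldType) (W : vectType K) (P : W -> Prop) :
  P 0 -> (forall a u v, P u -> P v -> P (a *: u + v)) ->
  exists U : {vspace W}, forall v, v \in U <-> P v.
Proof.
move=> P0 PL.
have step (U : {vspace W}) : (forall v, v \in U -> P v) ->
    exists U' : {vspace W}, forall v, v \in U' <-> P v.
  have [m] := ubnP (codim U); elim: m U => // m IHm U codU PU.
  have [PU'|nPU] := EM (forall v, P v -> v \in U).
    by exists U => v; split; [exact: PU | exact: PU'].
  have [v /not_implyP[Pv /negP vU]] : exists v, ~ (P v -> v \in U).
    exact/existsNP.
  apply: (IHm (U + <[v]>)%VS) => [|w /memv_addP[u uU [_ /vlineP[k ->] ->]]].
    have U_lt : (\dim U < \dim (U + <[v]>))%N.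
      rewrite ltn_neqAle dimv_leqif_eq ?addvSl //= dimvS ?addvSl // andbT.
      by apply: contraNneq vU => ->; rewrite memvE addvSr.
    have le_full : (\dim (U + <[v]>) <= \dim {:W})%N by rewrite dimvS ?subvf.
    by rewrite /codim in codU *; lia.
  by rewrite addrC; apply: PL => //; apply: PU.
by apply: (step 0%VS) => v; rewrite memv0 => /eqP->.
Qed.

Section Bicomplex.

Variables (K : fieldType) (T : finType) (rk : T -> nat) (le : rel T).
Variable chi : T -> color.

(** [le] stands for inclusion of strata and [rk] for codimension, so [P] is the smaller stratum. The
    construction sees the arrangement only through this poset. *)
Definition covers (P S : T) : bool := le P S && (rk P == (rk S).+1).
Local Notation cov := covers.

Hypothesis le_anti : antisymmetric le.
Hypothesis le_trans : transitive le.
Hypothesis cov_meet : forall S S' V, cov S V -> cov S' V -> S != S' ->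
  exists2 P, cov P S & cov P S'.
Hypothesis cov_glb : forall P Q S S', S != S' ->
  cov P S -> cov P S' -> le Q S -> le Q S' -> le Q P.

Section Data.
Variables (W : vectType K) (U : nat -> T -> {vspace W}).
Variables (D1 D2 : nat -> T -> T -> 'End(W)).

(** All the spaces lie in one [W]. For a given stratum the index [a] determines both degrees, so all
    bidegrees are treated at once. *)
Definition row_exact (P : T) : Prop :=
  (forall a v, v \in U a P -> (forall S, D1 a P S v = 0) -> v = 0) /\
  (forall a (y : T -> W), (forall S, y S \in U a S) ->
     (forall V, \sum_(S | cov P S) D1 a S V (y S) = 0) ->
     exists2 v, v \in U a.+1 P & forall S, cov P S -> D1 a.+1 P S v = y S).

Definition col_exact (P : T) : Prop :=
  (forall a v, v \in U a P ->
     exists2 y : T -> W, forall S, y S \in U a S & v = \sum_S D2 a P S (y S)) /\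
  (forall a (y : T -> W), (forall S, y S \in U a S) ->
     \sum_S D2 a P S (y S) = 0 ->
     exists2 z : T -> W, forall V, z V \in U a V &
       forall S, cov P S -> y S = \sum_V D2 a S V (z V)).

(* The space A_{i,j}^S is [U i.+1 S], where i + j = rk S: the index is shifted
   so that the row of S ends with [U 0 S = 0]. *)
Record os_bicomplex (c : nat) : Prop := OsBicomplex {
  os_gt : forall a S, ((rk S).+1 < a)%N -> U a S = 0%VS;
  os_0 : forall S, U 0 S = 0%VS;
  os_top : forall S, rk S = 0%N -> \dim (U 1 S) = 1%N;
  os_ncov1 : forall a P S, ~~ cov P S -> D1 a P S = 0;
  os_ncov2 : forall a P S, ~~ cov P S -> D2 a P S = 0;
  os_in1 : forall a P S v, (rk P <= c)%N -> v \in U a P ->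
    D1 a P S v \in U a.-1 S;
  os_in2 : forall a P S v, (rk P <= c)%N -> v \in U a S ->
    D2 a P S v \in U a P;
  os_d1d1 : forall a P V v, (rk P <= c)%N -> v \in U a P ->
    \sum_S D1 a.-1 S V (D1 a P S v) = 0;
  os_d2d2 : forall a P V v, (rk P <= c)%N -> v \in U a V ->
    \sum_S D2 a P S (D2 a S V v) = 0;
  os_d2d1 : forall a S v, (rk S <= c)%N -> v \in U a S ->
    \sum_V D2 a.-1 S V (D1 a S V v) = 0;
  os_d1d2 : forall a P S S' v, (rk P <= c)%N -> cov P S -> cov P S' ->
    v \in U a S ->
    D1 a P S' (D2 a P S v) = \sum_V D2 a.-1 S' V (D1 a S V v);
  os_row : forall P, (0 < rk P <= c)%N -> chi P = Lambda -> row_exact P;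
  os_col : forall P, (0 < rk P <= c)%N -> chi P = Mu -> col_exact P
}.
End Data.

Lemma os_bicomplex0 : exists (W : vectType K) U D1 D2, @os_bicomplex W U D1 D2 0.
Proof.
exists K^o, (fun a S => if (a == 1%N) && (rk S == 0%N) then fullv else 0%VS).
exists (fun _ _ _ => 0), (fun _ _ _ => 0); split=> //.
- by move=> [|[|a]] S.
- by move=> S ->; rewrite dimvf.
- by move=> *; rewrite lfunE mem0v.
- by move=> *; rewrite lfunE mem0v.
- by move=> *; rewrite big1 // => *; rewrite lfunE.
- by move=> *; rewrite big1 // => *; rewrite lfunE.
- by move=> *; rewrite big1 // => *; rewrite lfunE.
- by move=> a P S S' v; rewrite leqn0 /covers => /eqP-> /andP[].
- by move=> P /andP[]; lia.
- by move=> P /andP[]; lia.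
Qed.

(** * Inductive step: extension to the strata of codimension c + 1 *)

Section Step.
Variables (c : nat) (W : vectType K) (U : nat -> T -> {vspace W}).
Variables (D1 D2 : nat -> T -> T -> 'End(W)).
Hypothesis H : os_bicomplex U D1 D2 c.

Let d1_0 a P S v : ~~ cov P S -> D1 a P S v = 0.
Proof. by move=> nPS; rewrite (os_ncov1 H) // lfunE. Qed.

Let d2_0 a P S v : ~~ cov P S -> D2 a P S v = 0.
Proof. by move=> nPS; rewrite (os_ncov2 H) // lfunE. Qed.

Let cov_rk P S : cov P S -> rk P = (rk S).+1.
Proof. by case/andP=> _ /eqP. Qed.

Let cov_le P S : cov P S -> le P S.
Proof. by case/andP. Qed.

Definition d2d1 a S' S : W -> W := fun v => \sum_V D2 a.-1 S' V (D1 a S V v).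

Let d2d1_linear a S' S : linear (d2d1 a S' S).
Proof.
move=> k u v; rewrite /d2d1 scaler_sumr -big_split; apply: eq_bigr => V _ /=.
by rewrite !linearP.
Qed.

(** The fields [os_d2d1] and [os_d1d2] are the commutation of d' and d'' over the smallest possible
    strata; this gives it over any [Sg]. Distinct [V] and [V'] have at most one stratum of
    codimension 1 in both, and it contains [Sg]. If there is none, then by [cov_meet] they do not
    both have codimension 1 in a common stratum, and both sides vanish. *)
Lemma d1d2_sum Sg a V V' v : (rk V < c)%N -> le Sg V -> le Sg V' ->
  v \in U a V ->
  \sum_(S | le Sg S) D1 a S V' (D2 a S V v) = d2d1 a V' V v.
Proof.
move=> Vc SgV SgV' vU.
have rk_c S : cov S V -> (rk S <= c)%N by move=> /cov_rk->.
have [e|ne] := eqVneq V V'.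
  subst V'; rewrite /d2d1 (os_d2d1 H) ?big1 //; last exact: ltnW.
  move=> S _; have [SV|nSV] := boolP (cov S V); last by rewrite d1_0.
  by rewrite (os_d1d2 H) ?rk_c // (os_d2d1 H) // ltnW.
have [[S SV SV']|nS] := EM (exists2 S, cov S V & cov S V').
  rewrite (bigD1 S) ?(cov_glb ne SV SV') //= big1 ?addr0; last first.
    move=> S' /andP[_ S'S].
    have [S'V|nSV] := boolP (cov S' V); last by rewrite d2_0 // linear0.
    have [S'V'|nSV'] := boolP (cov S' V'); last by rewrite d1_0.
    case/eqP: S'S; apply: le_anti.
    by rewrite (cov_glb ne SV SV') ?(cov_glb ne S'V S'V') ?cov_le.
  by rewrite (os_d1d2 H) // rk_c.
rewrite big1 => [|S _]; last first.
  have [SV|nSV] := boolP (cov S V); last by rewrite d2_0 // linear0.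
  have [SV'|nSV'] := boolP (cov S V'); last by rewrite d1_0.
  by case: nS; exists S.
rewrite /d2d1 big1 // => X _.
have [VX|nVX] := boolP (cov V X); last by rewrite d1_0 // linear0.
have [V'X|nV'X] := boolP (cov V' X); last by rewrite d2_0.
by case: nS; apply: cov_meet VX V'X ne.
Qed.

Let d1d2_below a P V V' v : (rk P <= c.+1)%N -> le P V -> le P V' ->
  rk P = (rk V).+2 -> v \in U a V ->
  \sum_(S | cov P S) D1 a S V' (D2 a S V v) = d2d1 a V' V v.
Proof.
move=> Pc PV PV' rV vU; rewrite -(d1d2_sum _ PV PV' vU); last by lia.
rewrite [LHS]big_mkcond [RHS]big_mkcond; apply: eq_bigr => S _.
rewrite {1}/covers; case: (le P S) => //=; case: eqP => // rS.
have [/cov_rk SV|nSV] := boolP (cov S V); last by rewrite d2_0 ?linear0.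
by lia.
Qed.

Let d2d1_sum a P V (y : T -> W) : (forall S, y S \in U a S) ->
  (forall X, \sum_(S | cov P S) D1 a S X (y S) = 0) ->
  \sum_(S | cov P S) d2d1 a V S (y S) = 0.
Proof.
move=> yU y0; rewrite exchange_big big1 // => X _ /=.
by rewrite -linear_sum y0 linear0.
Qed.

(** Commuting d' past d'' turns d'd''d' into d''d'd' = 0. The commutation needs [P] to lie in [V];
    if no stratum lies between them, the sum is zero term by term. *)
Let d1_d2d1 a P S V v : rk P = c.+1 -> cov P S -> v \in U a S ->
  \sum_(S' | cov P S') D1 a.-1 S' V (d2d1 a S' S v) = 0.
Proof.
move=> rP PS vU; have rPS := cov_rk PS.
have [S0|nS0] := EM (exists2 S', cov P S' & cov S' V); last first.
  rewrite big1 // => S' PS'; rewrite d1_0 //; apply/negP => S'V.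
  by case: nS0; exists S'.
have [S0' PS0 S0V] := S0; have rS0 := cov_rk PS0; have rS0V := cov_rk S0V.
under eq_bigr do rewrite /d2d1 linear_sum.
rewrite exchange_big /=.
under eq_bigr => X _.
  have -> : \sum_(S' | cov P S') D1 a.-1 S' V (D2 a.-1 S' X (D1 a S X v)) =
     d2d1 a.-1 V X (D1 a S X v).
    have [SX|nSX] := boolP (cov S X); last first.
      by rewrite d1_0 // /d2d1 !big1 // => *; rewrite !linear0.
    have rSX := cov_rk SX.
    apply: d1d2_below; rewrite ?rP //; try lia.
    - exact: le_trans (cov_le PS) (cov_le SX).
    - exact: le_trans (cov_le PS0) (cov_le S0V).
    - by apply: (os_in1 H) => //; lia.
  over.
rewrite /d2d1 exchange_big big1 //= => X _.
by rewrite -linear_sum (os_d1d1 H) ?linear0 //; lia.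
Qed.

(** An element of the direct sum of the A^S over the S in which [P] has codimension 1. Extension by
    zero makes this direct sum a subspace of a fixed vector space. *)
Definition cochain a P (y : {ffun T -> W}) : Prop :=
  forall S, y S \in U a S /\ (~~ cov P S -> y S = 0).

Definition d1_kernel a P (y : {ffun T -> W}) : Prop :=
  cochain a P y /\ forall V, \sum_(S | cov P S) D1 a S V (y S) = 0.

Definition d2_image a P (y : {ffun T -> W}) : Prop :=
  exists2 z : T -> W, forall V, z V \in U a V &
    forall S, y S = if cov P S then \sum_V D2 a S V (z V) else 0.

(** Dual to [d1_d2d1]: d''d'd'' = d''d''d' = 0. It makes d' well defined on the cokernel of d''. *)
Let d2d1_d2 a P V y : rk P = c.+1 -> cov P V -> d2_image a P y ->
  \sum_(S | cov P S) d2d1 a V S (y S) = 0.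
Proof.
move=> rP PV [z zU yE]; have rPV := cov_rk PV.
under eq_bigr => S PS do rewrite yE PS.
rewrite exchange_big /=.
pose good Z := le P Z && (rk P == (rk Z).+2).
have -> : \sum_X \sum_(S | cov P S) D2 a.-1 V X (D1 a S X (\sum_Z D2 a S Z (z Z)))
        = \sum_X \sum_(Z | good Z) D2 a.-1 V X (d2d1 a X Z (z Z)).
  apply: eq_bigr => X _.
  have [VX|nVX] := boolP (cov V X); last by rewrite !big1 // => *; rewrite d2_0.
  have rVX := cov_rk VX.
  rewrite -!linear_sum; congr (D2 _ _ _ _).
  under eq_bigr do rewrite linear_sum.
  rewrite exchange_big (bigID good) /= [X in _ + X]big1 ?addr0 => [|Z nZ].
    apply: eq_bigr => Z /andP[PZ /eqP rZ]; apply: d1d2_below => //; try lia.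
    exact: le_trans (cov_le PV) (cov_le VX).
  rewrite big1 // => S PS; rewrite d2_0 ?linear0 //; apply: contra nZ => SZ.
  have rPS := cov_rk PS; have rSZ := cov_rk SZ.
  by rewrite /good (le_trans (cov_le PS) (cov_le SZ)) rPS rSZ eqxx.
rewrite exchange_big big1 //= => Z /andP[PZ /eqP rZ].
under eq_bigr do rewrite /d2d1 linear_sum.
rewrite exchange_big big1 //= => Q _.
have [ZQ|nZQ] := boolP (cov Z Q); last first.
  by rewrite d1_0 // big1 // => *; rewrite !linear0.
by rewrite (os_d2d2 H) //; [lia | apply: (os_in1 H) => //; lia].
Qed.

(** The cokernel of d'' is realized as a complement of the image: [pi] is the identity minus a
    projection onto the image, so [y] and [pi a P y] represent the same class. *)
Lemma d2_quotient : exists pi : nat -> T -> 'End({ffun T -> W}), forall a P,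
  (forall y, d2_image a P y -> pi a P y = 0) /\
  (forall y, d2_image a P (y - pi a P y)).
Proof.
suff /choice[pi piP] : forall aP : nat * T, exists p : 'End({ffun T -> W}),
    (forall y, d2_image aP.1 aP.2 y -> p y = 0) /\
    (forall y, d2_image aP.1 aP.2 (y - p y)).
  by exists (fun a P => pi (a, P)) => a P; apply: (piP (a, P)).
case=> a P /=.
have [||Q QP] := @linear_vspace K {ffun T -> W} (d2_image a P).
- exists (fun=> 0) => [V|S]; first exact: mem0v.
  by rewrite ffunE big1 ?if_same // => *; rewrite linear0.
- move=> k u v [y yU uE] [z zU vE]; exists (fun V => k *: y V + z V) => [V|S].
    by rewrite memvD ?memvZ.
  rewrite !ffunE uE vE; case: ifP => _; last by rewrite scaler0 addr0.
  by rewrite scaler_sumr -big_split; apply: eq_bigr => V _; rewrite linearP.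
exists (\1 - projv Q)%VF; split=> y.
  by move/QP=> yQ; rewrite add_lfunE opp_lfunE id_lfunE projv_id // subrr.
by apply/QP; rewrite add_lfunE opp_lfunE id_lfunE opprB addrC subrK memv_proj.
Qed.


Section NewLevel.
Variables (pi : nat -> T -> 'End({ffun T -> W})) (P : T).
Hypothesis pi0 : forall a y, d2_image a P y -> pi a P y = 0.
Hypothesis piB : forall a y, d2_image a P (y - pi a P y).
Hypothesis rP : rk P = c.+1.

Let rk_cov S : cov P S -> rk S = c.
Proof. by move/cov_rk; rewrite rP => -[]. Qed.

(** The kernel of d' sits in degree i - 1, hence the predecessor of [a] for color lambda; d''
    preserves i, hence the same [a] for color mu. *)
Definition new_space a (y : {ffun T -> W}) : Prop :=
  if chi P is Lambda then if a is a'.+1 then d1_kernel a' P y else y = 0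
  else exists2 y', cochain a P y' & y = pi a P y'.

(** For color lambda this is the inclusion of the kernel. For color mu it is forced: the class of y
    is d''y, and d'd''y must be d''d'y. Dually, d'' is forced in [new_d2] when the color is
    lambda. *)
Definition new_d1 a S (y : {ffun T -> W}) : W :=
  if chi P is Lambda then y S else \sum_(S' | cov P S') d2d1 a S S' (y S').

Definition new_d2 a S (w : W) : {ffun T -> W} :=
  if chi P is Lambda then [ffun S' => if cov P S' then d2d1 a S' S w else 0]
  else pi a P [ffun S' => if S' == S then w else 0].

Let sum_single (y : T -> W) :
  \sum_(S | cov P S) [ffun S' => if S' == S then y S else 0] =
  [ffun S => if cov P S then y S else 0] :> {ffun T -> W}.
Proof.
apply/ffunP => S; rewrite sum_ffunE ffunE big_mkcond (bigD1 S) //=.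
rewrite [X in _ + X]big1 ?addr0 ?ffunE ?eqxx // => S' S'S.
by rewrite ffunE eq_sym (negPf S'S) if_same.
Qed.

Lemma cochainL a : forall k u v, cochain a P u -> cochain a P v ->
  cochain a P (k *: u + v).
Proof.
move=> k u v Yu Yv S; have [uS u0] := Yu S; have [vS v0] := Yv S.
split; first by rewrite !ffunE memvD ?memvZ.
by move=> nPS; rewrite !ffunE u0 // v0 // scaler0 addr0.
Qed.

Lemma cochain0 a : cochain a P 0.
Proof. by move=> S; rewrite ffunE mem0v. Qed.

Lemma cochain_single a S w : cov P S -> w \in U a S ->
  cochain a P [ffun S' => if S' == S then w else 0].
Proof.
move=> PS wU S'; rewrite ffunE; have [->|_] := eqVneq S' S.
  by split=> //; rewrite PS.
by rewrite mem0v.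
Qed.

Lemma d2_image_cochain a y : d2_image a P y -> cochain a P y.
Proof.
move=> [z zU yE] S; rewrite yE; split; last by move/negPf->.
case: ifP => PS; last exact: mem0v.
by apply: memv_suml => V _; apply: (os_in2 H) => //; rewrite rk_cov.
Qed.

Lemma cochain_pi a y : cochain a P y -> cochain a P (pi a P y).
Proof.
move=> Yy; have -> : pi a P y = -1 *: (y - pi a P y) + y.
  by rewrite scaleN1r opprB subrK.
exact/cochainL/Yy/d2_image_cochain/piB.
Qed.

Lemma d2d1_in a S S' w : cov P S -> w \in U a S -> d2d1 a S' S w \in U a.-1 S'.
Proof.
move=> PS wU; apply: memv_suml => V _.
have [S'V|nS'V] := boolP (cov S' V); last by rewrite d2_0 ?mem0v.
have [SV|nSV] := boolP (cov S V); last by rewrite d1_0 // linear0 mem0v.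
have := cov_rk SV; have := cov_rk S'V; have := rk_cov PS => *.
by apply: (os_in2 H); [lia | apply: (os_in1 H) => //; lia].
Qed.

Lemma new_d1_linear a S : linear (new_d1 a S).
Proof.
move=> k u v; rewrite /new_d1; case: (chi P); first by rewrite !ffunE.
rewrite scaler_sumr -big_split; apply: eq_bigr => S' _.
by rewrite !ffunE d2d1_linear.
Qed.

Lemma new_d2_linear a S : linear (new_d2 a S).
Proof.
move=> k u v; rewrite /new_d2; case: (chi P).
  apply/ffunP => S'; rewrite !ffunE; case: ifP => _; last by rewrite scaler0 addr0.
  by rewrite d2d1_linear.
rewrite -linearP; congr (pi a P _); apply/ffunP => S'; rewrite !ffunE.
by case: ifP; rewrite // scaler0 addr0.
Qed.

Lemma new_space0 a : new_space a 0.
Proof.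
rewrite /new_space; case: (chi P); last by exists 0; rewrite ?linear0 //; apply: cochain0.
case: a => // a; split; first exact: cochain0.
by move=> V; rewrite big1 // => *; rewrite ffunE linear0.
Qed.

Lemma new_spaceL a k u v : new_space a u -> new_space a v -> new_space a (k *: u + v).
Proof.
rewrite /new_space; case: (chi P); last first.
  move=> [y Yy ->] [z Yz ->]; exists (k *: y + z); last by rewrite linearP.
  exact: cochainL.
case: a => [->->|a [Yu u0] [Yv v0]]; first by rewrite scaler0 addr0.
split=> [|V]; first exact: cochainL.
under eq_bigr do rewrite !ffunE linearP.
by rewrite big_split /= -scaler_sumr u0 v0 scaler0 addr0.
Qed.

Lemma new_space_gt a y : (c.+2 < a)%N -> new_space a y -> y = 0.
Proof.
move=> ca; have Y0 b z : (c.+1 < b)%N -> cochain b P z -> z = 0.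
  move=> cb Yz; apply/ffunP => S; rewrite ffunE; have [zS z0] := Yz S.
  have [PS|/z0//] := boolP (cov P S).
  by move: zS; rewrite (os_gt H) ?rk_cov // memv0 => /eqP.
rewrite /new_space; case: (chi P); last first.
  by move=> [z Yz ->]; rewrite (Y0 _ _ (ltnW ca) Yz) linear0.
by case: a ca => // a ca [Yy _]; apply: Y0 Yy.
Qed.

Lemma new_space_0 y : new_space 0 y -> y = 0.
Proof.
rewrite /new_space; case: (chi P) => // -[z Yz ->].
suff -> : z = 0 by rewrite linear0.
apply/ffunP => S; rewrite ffunE; have [] := Yz S.
by rewrite (os_0 H) memv0 => /eqP.
Qed.

(** For color mu, [y] and its projection differ by an element of the image of d'', which d''d' kills
    by [d2d1_d2]. *)
Lemma new_d1_pi a S y : cov P S -> new_d1 a S y =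
  if chi P is Lambda then y S else new_d1 a S (pi a P y).
Proof.
move=> PS; rewrite /new_d1; case: (chi P) => //.
apply/eqP; rewrite -subr_eq0 -sumrB.
under eq_bigr => S' _.
  have -> : d2d1 a S S' (y S') - d2d1 a S S' (pi a P y S') =
     d2d1 a S S' ((y - pi a P y) S').
    by rewrite -scaleN1r addrC -d2d1_linear scaleN1r addrC !ffunE.
  over.
by rewrite d2d1_d2.
Qed.

Lemma new_d1_in a S y : cov P S -> new_space a y -> new_d1 a S y \in U a.-1 S.
Proof.
move=> PS; rewrite /new_d1 /new_space; case: (chi P) => [|[z Yz ->]].
  by case: a => [->|a [/(_ S)[]]]; rewrite ?ffunE ?mem0v.
apply: memv_suml => S' PS'; apply: d2d1_in => //.
by have [] := cochain_pi Yz S'.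
Qed.

Lemma new_d2_in a S w : cov P S -> w \in U a S -> new_space a (new_d2 a S w).
Proof.
move=> PS wU; rewrite /new_d2 /new_space; case: (chi P); last first.
  by exists [ffun S' => if S' == S then w else 0] => //; apply: cochain_single.
case: a wU => [|a] wU.
  move: wU; rewrite (os_0 H) memv0 => /eqP->; apply/ffunP => S'; rewrite !ffunE.
  by rewrite /d2d1 big1 ?if_same // => *; rewrite !linear0.
split=> [S'|V].
  rewrite ffunE; case: ifP => PS'; last by rewrite mem0v.
  by split=> //; apply: (@d2d1_in a.+1).
rewrite -[RHS](d1_d2d1 V rP PS wU) /=.
by apply: eq_bigr => S' PS'; rewrite ffunE PS'.
Qed.

Lemma new_d1d1 a V y : new_space a y ->
  \sum_(S | cov P S) D1 a.-1 S V (new_d1 a S y) = 0.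
Proof.
rewrite /new_d1 /new_space; case: (chi P) => [|[z Yz ->]].
  by case: a => [->|a []//]; rewrite big1 // => *; rewrite ffunE linear0.
under eq_bigr do rewrite linear_sum.
rewrite exchange_big big1 //= => S PS; rewrite d1_d2d1 //.
by have [] := cochain_pi Yz S.
Qed.

Lemma new_d2d2 a V v : v \in U a V ->
  \sum_(S | cov P S) new_d2 a S (D2 a S V v) = 0.
Proof.
move=> vU; have imV : d2_image a P [ffun S => if cov P S then D2 a S V v else 0].
  exists (fun V' => if V' == V then v else 0) => [V'|S].
    by case: eqP => [->|_]; rewrite ?mem0v.
  rewrite ffunE (bigD1 V) //= eqxx big1 ?addr0 // => V' /negPf->.
  by rewrite linear0.
rewrite /new_d2; case: (chi P); last first.
  by rewrite -linear_sum sum_single; apply: pi0.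
apply/ffunP => S'; rewrite sum_ffunE ffunE.
under eq_bigr do rewrite ffunE.
have [PS'|nPS'] := boolP (cov P S'); last by rewrite big1.
rewrite -[RHS](d2d1_d2 rP PS' imV); apply: eq_bigr => S PS.
by rewrite ffunE PS.
Qed.

Lemma new_d2d1 a y : new_space a y ->
  \sum_(S | cov P S) new_d2 a.-1 S (new_d1 a S y) = 0.
Proof.
rewrite /new_d1 /new_d2 /new_space; case: (chi P) => [|[z Yz ->]].
  case: a => [->|a [Yy y0]].
    apply/ffunP => S'; rewrite sum_ffunE ffunE big1 // => S _; rewrite !ffunE.
    by rewrite /d2d1 big1 ?if_same // => *; rewrite !linear0.
  apply/ffunP => S'; rewrite sum_ffunE ffunE.
  under eq_bigr do rewrite ffunE.
  have [PS'|nPS'] := boolP (cov P S'); last by rewrite big1.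
  rewrite d2d1_sum // => S; by have [] := Yy S.
rewrite -linear_sum; apply: pi0.
have := cochain_pi Yz; move: {z Yz}(pi a P z) => {}y Yy.
(* The family d''d'y is the image under d'' of the family d'y, hence vanishes in the cokernel. *)
exists (fun V => \sum_(S | cov P S) D1 a S V (y S)) => [V|S].
  apply: memv_suml => S PS; apply: (os_in1 H); first by rewrite rk_cov.
  by have [] := Yy S.
rewrite sum_single ffunE; case: ifP => // PS.
by rewrite /d2d1 exchange_big; apply: eq_bigr => V _; rewrite linear_sum.
Qed.

Lemma new_d1d2 a S S' w : cov P S -> cov P S' -> w \in U a S ->
  new_d1 a S' (new_d2 a S w) = d2d1 a S' S w.
Proof.
move=> PS PS' wU; rewrite /new_d2.
have := @new_d1_pi a S' [ffun X => if X == S then w else 0] PS'.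
rewrite /new_d1; case: (chi P) => [_|<-]; first by rewrite ffunE PS'.
rewrite (bigD1 S) //= big1 ?addr0 => [|X /andP[_ /negPf XS]].
  by rewrite ffunE eqxx.
by rewrite ffunE XS /d2d1 big1 // => *; rewrite !linear0.
Qed.

Lemma new_row_inj a y : chi P = Lambda -> new_space a y ->
  (forall S, cov P S -> new_d1 a S y = 0) -> y = 0.
Proof.
rewrite /new_d1 /new_space => ->; case: a => // a [Yy _] y0.
apply/ffunP => S; rewrite ffunE; have [PS|nPS] := boolP (cov P S).
  exact: y0.
by have [_] := Yy S; apply.
Qed.

Lemma new_row_surj a (y : T -> W) : chi P = Lambda ->
  (forall S, y S \in U a S) ->
  (forall V, \sum_(S | cov P S) D1 a S V (y S) = 0) ->
  exists2 v, new_space a.+1 v & forall S, cov P S -> new_d1 a.+1 S v = y S.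
Proof.
rewrite /new_d1 /new_space => -> yU y0.
exists [ffun S => if cov P S then y S else 0]; last by move=> S PS; rewrite ffunE PS.
split=> [S|V]; first by rewrite ffunE; case: ifP => _; rewrite ?mem0v.
by rewrite -[RHS](y0 V); apply: eq_bigr => S PS; rewrite ffunE PS.
Qed.

Let new_d2_sum a (y : T -> W) : chi P = Mu ->
  \sum_(S | cov P S) new_d2 a S (y S) =
  pi a P [ffun S => if cov P S then y S else 0].
Proof.
by rewrite /new_d2 => ->; rewrite -linear_sum sum_single.
Qed.

Lemma new_col_surj a v : chi P = Mu -> new_space a v ->
  exists2 y : T -> W, forall S, y S \in U a S &
    v = \sum_(S | cov P S) new_d2 a S (y S).
Proof.
rewrite /new_space => chiP; rewrite chiP => -[y Yy ->].
exists y => [S|]; first by have [] := Yy S.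
rewrite new_d2_sum //; congr (pi a P _); apply/ffunP => S; rewrite ffunE.
by have [_ y0] := Yy S; case: ifPn.
Qed.

Lemma new_col_inj a (y : T -> W) : chi P = Mu ->
  (forall S, y S \in U a S) -> \sum_(S | cov P S) new_d2 a S (y S) = 0 ->
  exists2 z : T -> W, forall V, z V \in U a V &
    forall S, cov P S -> y S = \sum_V D2 a S V (z V).
Proof.
move=> chiP yU; rewrite new_d2_sum // => piy0.
have := piB a [ffun S => if cov P S then y S else 0].
rewrite piy0 subr0 => -[z zU yE]; exists z => // S PS.
by have := yE S; rewrite ffunE PS.
Qed.

End NewLevel.

Lemma os_bicomplexS : exists (W' : vectType K) U' D1' D2',
  @os_bicomplex W' U' D1' D2' c.+1.
Proof.
have [pi piP] := d2_quotient.
have pi0 P a y := (piP a P).1 y.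
have piB P a y := (piP a P).2 y.
(* The old spaces live in the first factor, and those of the strata of codimension c + 1 in the
   second. *)
pose W' : vectType K := (W * {ffun T -> W})%type.
have sum_l I r (Q : pred I) (f : I -> W) :
    \sum_(i <- r | Q i) ((f i, 0) : W') = (\sum_(i <- r | Q i) f i, 0).
  by elim/big_rec2: _ => // i u v _ ->; congr (_, _); rewrite addr0.
have sum_r I r (Q : pred I) (f : I -> {ffun T -> W}) :
    \sum_(i <- r | Q i) ((0, f i) : W') = (0, \sum_(i <- r | Q i) f i).
  by elim/big_rec2: _ => // i u v _ ->; congr (_, _); rewrite addr0.
have pairL k (u v : W) u' v' :
    k *: ((u, u') : W') + (v, v') = (k *: u + v, k *: u' + v') by [].
pose new P := rk P == c.+1.
have /choice[U' U'P] : forall aP : nat * T, exists V : {vspace W'}, forall x,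
    x \in V <-> if new aP.2 then x.1 = 0 /\ new_space pi aP.2 aP.1 x.2
                else x.1 \in U aP.1 aP.2 /\ x.2 = 0.
  case=> a P /=; apply: linear_vspace => [|k [u u'] [v v']].
    by case: ifP => [/eqP rP|_]; split=> //=; [exact: new_space0 | exact: mem0v].
  case: ifP => [/eqP rP|_] [/= u0 uN] [/= v0 vN].
    by rewrite u0 v0 scaler0 addr0; split=> //; apply: new_spaceL.
  by rewrite uN vN scaler0 addr0 memvD ?memvZ.
(* d' always lands in the first factor, since a stratum in which a new one has codimension 1 is old;
   d'' lands in the second factor exactly when its target is new. *)
have /choice[E1 E1P] : forall t : nat * T * T, exists f : 'End(W'), f =1
    fun x : W' => if new t.1.2 then
      (if cov t.1.2 t.2 then new_d1 t.1.2 t.1.1 t.2 x.2 else 0, 0)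
    else (D1 t.1.1 t.1.2 t.2 x.1, 0).
  case=> [[a P] S] /=; apply: linear_hom => k [u u'] [v v'] /=.
  case: ifP => _; rewrite !pairL /= scaler0 addr0; last by rewrite linearP.
  congr (_, _).
  by case: ifP => _; rewrite ?scaler0 ?addr0 // new_d1_linear.
have /choice[E2 E2P] : forall t : nat * T * T, exists f : 'End(W'), f =1
    fun x : W' => if new t.1.2 then
      (0, if cov t.1.2 t.2 then new_d2 pi t.1.2 t.1.1 t.2 x.1 else 0)
    else (D2 t.1.1 t.1.2 t.2 x.1, 0).
  case=> [[a P] S] /=; apply: linear_hom => k [u u'] [v v'] /=.
  case: ifP => _; rewrite !pairL /= scaler0 addr0; last by rewrite linearP.
  congr (_, _).
  by case: ifP => _; rewrite ?scaler0 ?addr0 // new_d2_linear.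
exists W', (fun a P => U' (a, P)), (fun a P S => E1 (a, P, S)),
  (fun a P S => E2 (a, P, S)).
have UN a P x : new P -> x \in U' (a, P) <-> x.1 = 0 /\ new_space pi P a x.2.
  by move=> nP; have := U'P (a, P) x; rewrite /= nP.
have UO a P x : ~~ new P -> x \in U' (a, P) <-> x.1 \in U a P /\ x.2 = 0.
  by move=> /negPf nP; have := U'P (a, P) x; rewrite /= nP.
have E1N a P S x : new P -> cov P S -> E1 (a, P, S) x = (new_d1 P a S x.2, 0).
  by move=> nP PS; rewrite E1P /= nP PS.
have E1O a P S x : ~~ new P -> E1 (a, P, S) x = (D1 a P S x.1, 0).
  by move=> /negPf nP; rewrite E1P /= nP.
have E2N a P S x : new P -> cov P S -> E2 (a, P, S) x = (0, new_d2 pi P a S x.1).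
  by move=> nP PS; rewrite E2P /= nP PS.
have E2O a P S x : ~~ new P -> E2 (a, P, S) x = (D2 a P S x.1, 0).
  by move=> /negPf nP; rewrite E2P /= nP.
have E1_0 a P S x : ~~ cov P S -> E1 (a, P, S) x = 0.
  by move=> nPS; rewrite E1P /= (negPf nPS) d1_0 // if_same.
have E2_0 a P S x : ~~ cov P S -> E2 (a, P, S) x = 0.
  by move=> nPS; rewrite E2P /= (negPf nPS) d2_0 // if_same.
have below P S : new P -> cov P S -> (rk S <= c)%N /\ ~~ new S.
  by move=> /eqP rP PS; have := cov_rk PS; rewrite /new; lia.
have old P : (rk P <= c.+1)%N -> ~~ new P -> (rk P <= c)%N.
  by rewrite /new; lia.
have oldS P S : (rk P <= c.+1)%N -> cov P S -> (rk S <= c)%N /\ ~~ new S.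
  by move=> rP PS; have := cov_rk PS; rewrite /new; lia.
split.
- move=> a S aS; apply/eqP; rewrite -subv0; apply/subvP=> x.
  have [nS|oS] := boolP (new S); last first.
    move/(UO _ _ _ oS) => []; rewrite (os_gt H) // memv0 => /eqP x1 x2.
    by rewrite memv0 [x]surjective_pairing x1 x2.
  move/(UN _ _ _ nS) => [x1 /new_space_gt x2].
  rewrite memv0 [x]surjective_pairing x1 x2 //; first exact/eqP.
  by move/eqP: nS aS => ->.
- move=> S; apply/eqP; rewrite -subv0; apply/subvP=> x.
  have [nS|oS] := boolP (new S); last first.
    move/(UO _ _ _ oS) => []; rewrite (os_0 H) // memv0 => /eqP x1 x2.
    by rewrite memv0 [x]surjective_pairing x1 x2.
  move/(UN _ _ _ nS) => [x1 /new_space_0 x2].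
  by rewrite memv0 [x]surjective_pairing x1 x2.
- move=> S rS; have oS : ~~ new S by rewrite /new rS.
  have [inl inlE] : exists f : 'Hom(W, W'), f =1 fun w => (w, 0).
    by apply: linear_hom => k u v; rewrite !pairL scaler0 addr0.
  have -> : U' (1%N, S) = (inl @: U 1 S)%VS.
    apply/vspaceP => x; apply/idP/memv_imgP => [/(UO _ _ _ oS)[x1 x2]|[w wU ->]].
      by exists x.1; rewrite // inlE -x2 -surjective_pairing.
    by apply/(UO _ _ _ oS); rewrite inlE.
  rewrite limg_dim_eq ?(os_top H) //; apply/eqP; rewrite -subv0.
  apply/subvP => w /memv_capP[_]; rewrite memv_ker inlE memv0 => /eqP[->].
  by [].
- by move=> a P S nPS; apply/lfunP => x; rewrite E1_0 // lfunE.
- by move=> a P S nPS; apply/lfunP => x; rewrite E2_0 // lfunE.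
- move=> a P S x rP; have [PS|nPS _] := boolP (cov P S); last first.
    by rewrite E1_0 // mem0v.
  have [rS oS] := oldS _ _ rP PS.
  have [nP /(UN _ _ _ nP)[x1 x2]|oP /(UO _ _ _ oP)[x1 x2]] := boolP (new P).
    rewrite E1N //; apply/(UO _ _ _ oS); split=> //=.
    by apply: new_d1_in x2 => //; apply/eqP.
  rewrite E1O //; apply/(UO _ _ _ oS); split=> //=.
  by apply: (os_in1 H) => //; apply: old.
- move=> a P S x rP; have [PS|nPS _] := boolP (cov P S); last first.
    by rewrite E2_0 // mem0v.
  have [rS oS] := oldS _ _ rP PS.
  move=> /(UO _ _ _ oS)[x1 x2].
  have [nP|oP] := boolP (new P).
    rewrite E2N //; apply/(UN _ _ _ nP); split=> //=.
    by apply: new_d2_in => //; apply/eqP.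
  rewrite E2O //; apply/(UO _ _ _ oP); split=> //=.
  by apply: (os_in2 H) => //; apply: old.
- move=> a P V x rP; have [nP|oP] := boolP (new P).
    move=> /(UN _ _ _ nP)[x1 x2].
    under eq_bigr => S _.
      have -> : E1 (a.-1, S, V) (E1 (a, P, S) x) =
          (if cov P S then D1 a.-1 S V (new_d1 P a S x.2) else 0, 0).
        case: ifPn => [PS|nPS]; last by rewrite (E1_0 _ _ _ _ nPS) linear0.
        have [rS oS] := oldS _ _ rP PS.
        by rewrite (E1N _ _ _ _ nP PS) (E1O _ _ _ _ oS).
      over.
    by rewrite sum_l -big_mkcond (new_d1d1 (piB P) (eqP nP) _ x2).
  move=> /(UO _ _ _ oP)[x1 x2].
  under eq_bigr => S _.
    have -> : E1 (a.-1, S, V) (E1 (a, P, S) x) = (D1 a.-1 S V (D1 a P S x.1), 0).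
      have [PS|nPS] := boolP (cov P S); last first.
        by rewrite (E1_0 _ _ _ _ nPS) (d1_0 _ _ nPS) !linear0.
      by have [rS oS] := oldS _ _ rP PS; rewrite (E1O _ _ _ _ oS) (E1O _ _ _ _ oP).
    over.
  by rewrite sum_l (os_d1d1 H) //; apply: old.
- move=> a P V x rP xU.
  (* A nonzero composite of two maps d'' raises the codimension by 2, so [V] must be old. *)
  have [rV|PV] := leqP (rk V).+2 (rk P); last first.
    rewrite big1 // => S _; have [PS|nPS] := boolP (cov P S); last by rewrite E2_0.
    rewrite (E2_0 _ S V) ?linear0 //; apply/negP => SV.
    by have := cov_rk PS; have := cov_rk SV; lia.
  have oV : ~~ new V by rewrite /new; lia.
  have [x1 _] : x.1 \in U a V /\ x.2 = 0 by apply/(UO _ _ _ oV).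
  have [nP|oP] := boolP (new P).
    under eq_bigr => S _.
      have -> : E2 (a, P, S) (E2 (a, S, V) x) =
          (0, if cov P S then new_d2 pi P a S (D2 a S V x.1) else 0).
        case: ifPn => [PS|nPS]; last by rewrite E2_0.
        have [rS oS] := oldS _ _ rP PS.
        by rewrite (E2N _ _ _ _ nP PS) (E2O _ _ _ _ oS).
      over.
    by rewrite sum_r -big_mkcond (new_d2d2 (pi0 P) (eqP nP) x1).
  under eq_bigr => S _.
    have -> : E2 (a, P, S) (E2 (a, S, V) x) = (D2 a P S (D2 a S V x.1), 0).
      have [PS|nPS] := boolP (cov P S); last by rewrite E2_0 // d2_0.
      have [rS oS] := oldS _ _ rP PS.
      by rewrite (E2O _ _ _ _ oP) (E2O _ _ _ _ oS).
    over.
  by rewrite sum_l (os_d2d2 H) //; apply: old.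
- move=> a P x rP; have [nP|oP] := boolP (new P).
    move=> /(UN _ _ _ nP)[x1 x2].
    under eq_bigr => S _.
      have -> : E2 (a.-1, P, S) (E1 (a, P, S) x) =
          (0, if cov P S then new_d2 pi P a.-1 S (new_d1 P a S x.2) else 0).
        case: ifPn => [PS|nPS]; last by rewrite (E1_0 _ _ _ _ nPS) linear0.
        by rewrite (E1N _ _ _ _ nP PS) (E2N _ _ _ _ nP PS).
      over.
    by rewrite sum_r -big_mkcond (new_d2d1 (pi0 P) (piB P) (eqP nP) x2).
  move=> /(UO _ _ _ oP)[x1 x2].
  under eq_bigr => S _.
    have -> : E2 (a.-1, P, S) (E1 (a, P, S) x) = (D2 a.-1 P S (D1 a P S x.1), 0).
      have [PS|nPS] := boolP (cov P S); last first.
        by rewrite (E1_0 _ _ _ _ nPS) (d1_0 _ _ nPS) !linear0.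
      by rewrite (E2O _ _ _ _ oP) (E1O _ _ _ _ oP).
    over.
  by rewrite sum_l (os_d2d1 H) //; apply: old.
- move=> a P S S' x rP PS PS'.
  have [rS oS] := oldS _ _ rP PS; have [rS' oS'] := oldS _ _ rP PS'.
  move=> /(UO _ _ _ oS)[x1 x2].
  under eq_bigr do rewrite (E1O _ _ _ _ oS) (E2O _ _ _ _ oS') /=.
  rewrite sum_l; have [nP|oP] := boolP (new P).
    by rewrite (E2N _ _ _ _ nP PS) (E1N _ _ _ _ nP PS') (new_d1d2 (piB P) (eqP nP)).
  by rewrite (E2O _ _ _ _ oP) (E1O _ _ _ _ oP) /= (os_d1d2 H) //; apply: old.
(* Only the strata in which [P] has codimension 1 matter; they are old, so [cut] replaces the family
   by one with values in [W]. *)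
- move=> P /andP[rP0 rP] chiP; have cut a (y : T -> W') :
      (forall S, y S \in U' (a, S)) -> exists2 w : T -> W,
      forall S, w S \in U a S & forall S, cov P S -> y S = (w S, 0).
    move=> yU; exists (fun S => if cov P S then (y S).1 else 0) => S.
      case: ifP => [PS|_]; last exact: mem0v.
      by have [rS oS] := oldS _ _ rP PS; case/(UO _ _ _ oS): (yU S).
    move=> PS; have [rS oS] := oldS _ _ rP PS; rewrite PS.
    by case/(UO _ _ _ oS): (yU S) => _ <-; rewrite -surjective_pairing.
  have d1_cut a (y : T -> W') (w : T -> W) V :
      (forall S, cov P S -> y S = (w S, 0)) ->
      \sum_(S | cov P S) E1 (a, S, V) (y S) =
      (\sum_(S | cov P S) D1 a S V (w S), 0).
    move=> wE; rewrite -sum_l; apply: eq_bigr => S PS.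
    by have [rS oS] := oldS _ _ rP PS; rewrite wE // E1O.
  have [nP|oP] := boolP (new P).
    split=> [a x /(UN _ _ _ nP)[x1 x2] x0|a y yU y0].
      rewrite [x]surjective_pairing x1; congr (_, _).
      apply: new_row_inj x2 _ => // S PS; have := x0 S.
      by rewrite (E1N _ _ _ _ nP PS) => -[].
    have [w wU wE] := cut a y yU.
    have [|v vN vE] := new_row_surj pi chiP wU.
      by move=> V; have := y0 V; rewrite (d1_cut _ _ _ _ wE) => -[].
    exists (0, v) => [|S PS]; first by apply/(UN _ _ _ nP).
    by rewrite (E1N _ _ _ _ nP PS) wE // vE.
  have [|inj surj] := os_row H _ chiP; first by rewrite rP0 old.
  split=> [a x /(UO _ _ _ oP)[x1 x2] x0|a y yU y0].
    rewrite [x]surjective_pairing x2; congr (_, _).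
    by apply: inj x1 _ => S; have := x0 S; rewrite (E1O _ _ _ _ oP) => -[].
  have [w wU wE] := cut a y yU.
  have [|v vN vE] := surj a w wU.
    by move=> V; have := y0 V; rewrite (d1_cut _ _ _ _ wE) => -[].
  exists (v, 0) => [|S PS]; first by apply/(UO _ _ _ oP).
  by rewrite (E1O _ _ _ _ oP) wE // vE.
- move=> P /andP[rP0 rP] chiP; have cut a (y : T -> W') :
      (forall S, y S \in U' (a, S)) -> exists2 w : T -> W,
      forall S, w S \in U a S & forall S, cov P S -> y S = (w S, 0).
    move=> yU; exists (fun S => if cov P S then (y S).1 else 0) => S.
      case: ifP => [PS|_]; last exact: mem0v.
      by have [rS oS] := oldS _ _ rP PS; case/(UO _ _ _ oS): (yU S).
    move=> PS; have [rS oS] := oldS _ _ rP PS; rewrite PS.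
    by case/(UO _ _ _ oS): (yU S) => _ <-; rewrite -surjective_pairing.
  (* At new strata the spaces lie in the other factor, so the family is set to zero there. This does
     not change d'' on the strata in which [P] has codimension 1. *)
  pose lift (z : T -> W) V : W' := if new V then 0 else (z V, 0).
  have liftU a z : (forall V, z V \in U a V) -> forall V, lift z V \in U' (a, V).
    move=> zU V; rewrite /lift; case: ifPn => [_|oV]; first exact: mem0v.
    by apply/(UO _ _ _ oV); split=> //=; apply: zU.
  have d2_lift a z S : cov P S ->
      \sum_V E2 (a, S, V) (lift z V) = (\sum_V D2 a S V (z V), 0).
    move=> PS; have [rS oS] := oldS _ _ rP PS.
    rewrite -sum_l; apply: eq_bigr => V _.
    rewrite (E2O _ _ _ _ oS) /lift; case: ifPn => // nV.
    have nSV : ~~ cov S V by apply/negP => /cov_rk; move/eqP: nV; lia.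
    by rewrite !(d2_0 _ _ nSV).
  have [nP|oP] := boolP (new P).
    have d2_new a (y : T -> W') : \sum_S E2 (a, P, S) (y S) =
        (0, \sum_(S | cov P S) new_d2 pi P a S (y S).1).
      rewrite [in RHS]big_mkcond -sum_r; apply: eq_bigr => S _.
      case: ifPn => [PS|nPS]; first by rewrite (E2N _ _ _ _ nP PS).
      by rewrite (E2_0 _ _ _ _ nPS).
    split=> [a x /(UN _ _ _ nP)[x1 x2]|a y yU y0].
      have [z zU zE] := new_col_surj chiP x2; exists (lift z); first exact: liftU.
      rewrite d2_new [x]surjective_pairing x1 zE; congr (_, _).
      apply: eq_bigr => S PS; have [rS /negPf oS] := oldS _ _ rP PS.
      by rewrite /lift oS.
    have [w wU wE] := cut a y yU.
    have [|z zU zE] := new_col_inj (piB P) chiP wU.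
      move: y0; rewrite d2_new => -[y0]; rewrite -[RHS]y0.
      by apply: eq_bigr => S PS; rewrite wE.
    exists (lift z) => [|S PS]; first exact: liftU.
    by rewrite d2_lift // wE // zE.
  have d2_old a (y : T -> W') : \sum_S E2 (a, P, S) (y S) =
      (\sum_S D2 a P S (y S).1, 0).
    by rewrite -sum_l; apply: eq_bigr => S _; rewrite (E2O _ _ _ _ oP).
  have [|surj inj] := os_col H _ chiP; first by rewrite rP0 old.
  split=> [a x /(UO _ _ _ oP)[x1 x2]|a y yU y0].
    have [z zU zE] := surj a _ x1; exists (lift z); first exact: liftU.
    rewrite d2_old [x]surjective_pairing x2 zE; congr (_, _).
    apply: eq_bigr => S _; have [PS|nPS] := boolP (cov P S).
      by have [rS /negPf oS] := oldS _ _ rP PS; rewrite /lift oS.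
    by rewrite !(d2_0 _ _ nPS).
  have [w wU wE] := cut a y yU.
  have [|z zU zE] := inj a w wU.
    move: y0; rewrite d2_old => -[y0]; rewrite -[RHS]y0.
    apply: eq_bigr => S _; have [PS|nPS] := boolP (cov P S).
      by rewrite wE.
    by rewrite !(d2_0 _ _ nPS).
  exists (lift z) => [|S PS]; first exact: liftU.
  by rewrite d2_lift // wE // zE.
Qed.

End Step.

Lemma os_bicomplex_exists c : exists (W : vectType K) U D1 D2,
  @os_bicomplex W U D1 D2 c.
Proof.
elim: c => [|c [W [U [D1 [D2 H]]]]]; first exact: os_bicomplex0.
exact: os_bicomplexS H.
Qed.

End Bicomplex.

(** * Exactness of rows and columns *)

Section Exactness.

Variables (K : fieldType) (T : finType) (rk : T -> nat) (le : rel T).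
Variable chi : T -> color.
Hypothesis le_refl : reflexive le.
Hypothesis le_trans : transitive le.

Local Notation cov := (covers rk le).

(* h is the set of the strata lying in a given hyperplane. *)
Record hyperplane (h : pred T) : Prop := Hyperplane {
  hyp_le : forall P S, le P S -> h S -> h P;
  hyp_inj : forall V Q R, ~~ h V -> h Q -> h R -> cov Q V -> cov R V -> Q = R;
  hyp_meet : forall V P, ~~ h V -> h P -> le P V ->
    exists Q, [/\ h Q, cov Q V & le P Q]
}.

Variables (c : nat) (W : vectType K) (U : nat -> T -> {vspace W}).
Variables (D1 D2 : nat -> T -> T -> 'End(W)).
Hypothesis H : os_bicomplex rk le chi U D1 D2 c.
Hypothesis rk_le : forall P, (rk P <= c)%N.

Local Notation row_exact := (row_exact rk le U D1).
Local Notation col_exact := (col_exact rk le U D2).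

Let d1_0 a P S v : ~~ cov P S -> D1 a P S v = 0.
Proof. by move=> nPS; rewrite (os_ncov1 H) // lfunE. Qed.

Let d2_0 a P S v : ~~ cov P S -> D2 a P S v = 0.
Proof. by move=> nPS; rewrite (os_ncov2 H) // lfunE. Qed.

Let cov_rk P S : cov P S -> rk P = (rk S).+1.
Proof. by case/andP=> _ /eqP. Qed.

Let cov_le P S : cov P S -> le P S.
Proof. by case/andP. Qed.

Let U0 S v : v \in U 0 S -> v = 0.
Proof. by rewrite (os_0 H) memv0 => /eqP. Qed.

Let d1_in a P S v : v \in U a P -> D1 a P S v \in U a.-1 S.
Proof. exact: (os_in1 H). Qed.

Let d2_in a P S v : v \in U a S -> D2 a P S v \in U a P.
Proof. exact: (os_in2 H). Qed.

Let d1d1 a P V v : v \in U a P -> \sum_S D1 a.-1 S V (D1 a P S v) = 0.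
Proof. exact: (os_d1d1 H). Qed.

Let d2d2 a P V v : v \in U a V -> \sum_S D2 a P S (D2 a S V v) = 0.
Proof. exact: (os_d2d2 H). Qed.

Let cov2 P Q V : cov Q V -> le P Q -> rk P = (rk V).+2 -> cov P Q.
Proof. by move=> /cov_rk rQ PQ rP; rewrite /covers PQ rQ rP eqxx. Qed.

(** * Exactness of the rows *)

Section Row.
Variable h : pred T.
Hypothesis hypH : hyperplane h.

(** Let S in [h] be such that [P] has codimension 1 in S. For V not in [h], only S = V \cap h
    contributes to the component of d'd'x = 0 at V, the other ones of x being zero. So the component
    of x at S has zero restriction and vanishes by induction; then x = 0, as d' is injective on
    A^P. *)
Lemma restriction_inj P : h P -> (forall Q, le P Q -> h Q -> row_exact Q) ->
  forall a x, x \in U a P ->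
    (forall S, cov P S -> ~~ h S -> D1 a P S x = 0) -> x = 0.
Proof.
have [m] := ubnP (rk P); elim: m P => // m IHm P rP hP rowP a x xU x0.
have [inj _] := rowP P (le_refl P) hP; apply: (inj _ _ xU) => S.
have [PS|nPS] := boolP (cov P S); last exact: d1_0.
have [hS|] := boolP (h S); last exact: x0.
apply: (IHm S _ hS _ a.-1) => [|Q SQ||V SV nV].
- by have := cov_rk PS; lia.
- exact/rowP/(le_trans (cov_le PS)).
- exact: d1_in.
have := d1d1 V xU; rewrite (bigD1 S) //= big1 ?addr0 // => R RS.
have [RV|nRV] := boolP (cov R V); last by rewrite d1_0.
have [PR|nPR] := boolP (cov P R); last by rewrite (d1_0 _ _ nPR) linear0.
have [hR|nR] := boolP (h R); last by rewrite (x0 R) // linear0.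
by rewrite (hyp_inj hypH nV hR hS RV SV) eqxx in RS.
Qed.

(** The family [y], given off [h], is completed by induction on the strata in [h] to a cycle for d',
    which comes from A^P because the row of P is exact. *)
Lemma restriction_surj P : h P -> (forall Q, le P Q -> h Q -> row_exact Q) ->
  forall a (y : T -> W), (forall S, y S \in U a S) ->
    exists2 x, x \in U a.+1 P &
      forall S, cov P S -> ~~ h S -> D1 a.+1 P S x = y S.
Proof.
have [m] := ubnP (rk P); elim: m P => // m IHm P rP hP rowP a y yU.
case: a yU => [|a] yU.
  by exists 0 => [|S _ _]; rewrite ?mem0v // linear0 (U0 (yU S)).
(* The value that the one missing component, at V \cap h, must have at V for d'y' to vanish at V. *)
pose f V := - \sum_(R | cov P R && ~~ h R) D1 a.+1 R V (y R).
have fU V : f V \in U a V.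
  by rewrite memvN memv_suml // => R _; apply: d1_in.
have /choice[z zP] : forall Q, exists v, v \in U a.+1 Q /\ (cov P Q -> h Q ->
    forall V, cov Q V -> ~~ h V -> D1 a.+1 Q V v = f V).
  move=> Q; have [/andP[PQ hQ]|nQ] := boolP (cov P Q && h Q); last first.
    by exists 0; rewrite mem0v; split=> // PQ hQ; rewrite PQ hQ in nQ.
  have [|Q' QQ'|v vU vE] := IHm Q _ hQ _ a f fU; last by exists v.
    by have := cov_rk PQ; lia.
  exact/rowP/(le_trans (cov_le PQ)).
pose y' S := if h S then z S else y S.
have y'U S : y' S \in U a.+1 S.
  by rewrite /y'; case: ifP => // _; have [] := zP S.
have y'0 V : ~~ h V -> \sum_(S | cov P S) D1 a.+1 S V (y' S) = 0.
  move=> nV; have [[Q PQ QV]|nQ] := EM (exists2 Q, cov P Q & cov Q V); last first.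
    rewrite big1 // => S PS; rewrite d1_0 //; apply/negP => SV.
    by apply: nQ; exists S.
  have PV := le_trans (cov_le PQ) (cov_le QV).
  have rPV : rk P = (rk V).+2 by have := cov_rk PQ; have := cov_rk QV; lia.
  have [S [hS SV PS]] := hyp_meet hypH nV hP PV.
  have {}PS := cov2 SV PS rPV.
  rewrite (bigID h) /= (bigD1 S) /= ?PS //.
  rewrite [X in _ + X + _]big1 ?addr0 => [|R /andP[/andP[PR hR] RS]]; last first.
    rewrite d1_0 //; apply: contra RS => RV.
    by apply/eqP/(hyp_inj hypH nV).
  rewrite {1}/y' hS; have [_ ->] := zP S; rewrite // /f.
  apply/eqP; rewrite addrC subr_eq0; apply/eqP; apply: eq_bigr => R /andP[_ nR].
  by rewrite /y' (negPf nR).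
have [_ surj] := rowP P (le_refl P) hP.
have [|x xU xE] := surj a.+1 y' y'U; last first.
  by exists x => // S PS nS; rewrite xE // /y' (negPf nS).
move=> V; have [hV|] := boolP (h V); last exact: y'0.
have [[Q PQ QV]|nQ] := EM (exists2 Q, cov P Q & cov Q V); last first.
  rewrite big1 // => S PS; rewrite d1_0 //; apply/negP => SV.
  by apply: nQ; exists S.
have PV := le_trans (cov_le PQ) (cov_le QV).
(* At V in [h], d'y' has zero restriction: d'd'y' = 0, and d'y' is already zero off [h]. *)
apply: (@restriction_inj V hV _ a) => [Q' VQ'||X VX nX].
- exact/rowP/(le_trans PV).
- by apply: memv_suml => S _; apply: (@d1_in a.+1).
have : \sum_V' D1 a V' X (\sum_(S | cov P S) D1 a.+1 S V' (y' S)) = 0.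
  under eq_bigr do rewrite linear_sum.
  by rewrite exchange_big big1 //= => S _; apply: (@d1d1 a.+1).
rewrite (bigD1 V) //= [X in _ + X]big1 ?addr0 // => V' V'V.
have [hV'|nV'] := boolP (h V'); last by rewrite y'0 // linear0.
rewrite d1_0 //; apply: contra V'V => V'X.
by apply/eqP/(hyp_inj hypH nX).
Qed.

(** The strata in [h] suffice for a primitive: z on P in [h] is the element whose restriction off
    [h] is y, by [restriction_surj]. The difference y - d'z vanishes off [h]; being a cycle, it
    vanishes on [h] too by [restriction_inj]. *)
Lemma row_exact_above Sg : h Sg ->
  (forall Q, le Sg Q -> h Q -> row_exact Q) ->
  forall a (y : T -> W), (forall S, y S \in U a S) ->
    (forall V, le Sg V -> \sum_(S | le Sg S) D1 a S V (y S) = 0) ->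
    exists2 z : T -> W, forall S, z S \in U a.+1 S &
      forall S, le Sg S -> y S = \sum_(P | le Sg P) D1 a.+1 P S (z P).
Proof.
move=> hSg rowS a y yU y0.
have /choice[z zP] : forall P, exists v, v \in U a.+1 P /\
   if h P && le Sg P then forall S, cov P S -> ~~ h S -> D1 a.+1 P S v = y S
   else v = 0.
  move=> P; have [/andP[hP SgP]|_] := boolP (h P && le Sg P); last first.
    by exists 0; rewrite mem0v.
  have rowP Q : le P Q -> h Q -> row_exact Q.
    by move=> PQ; apply: rowS; apply: le_trans PQ.
  by have [v vU vE] := restriction_surj hP rowP yU; exists v.
exists z => [S|S SgS]; first by have [] := zP S.
pose t V := y V - \sum_(P | le Sg P) D1 a.+1 P V (z P).
suff tS : t S = 0 by apply/eqP; rewrite -subr_eq0; apply/eqP.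
have tU V : t V \in U a V.
  rewrite memvB // memv_suml // => P _; apply: (@d1_in a.+1).
  by have [] := zP P.
have t0 V : le Sg V -> ~~ h V -> t V = 0.
  move=> SgV nV; have [P [hP PV SgP]] := hyp_meet hypH nV hSg SgV.
  apply/eqP; rewrite subr_eq0 (bigD1 P) //= big1 ?addr0 => [|Q /andP[SgQ QP]].
    by have := (zP P).2; rewrite hP SgP => ->.
  have [_] := zP Q; case: ifP => [/andP[hQ _] _|_ ->]; last exact: linear0.
  rewrite d1_0 //; apply: contra QP => QV.
  by apply/eqP/(hyp_inj hypH nV).
have [hS|] := boolP (h S); last exact: t0.
apply: (@restriction_inj S hS _ a) => // [Q SQ|V SV nV].
  by apply: rowS; apply: le_trans SQ.
have SgV := le_trans SgS (cov_le SV).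
have : \sum_(S' | le Sg S') D1 a S' V (t S') = 0.
  under eq_bigr do rewrite linearB linear_sum.
  rewrite sumrB y0 // sub0r exchange_big big1 ?oppr0 //= => P SgP.
  have zU : z P \in U a.+1 P by have [] := zP P.
  rewrite -[RHS](d1d1 V zU) /= big_mkcond; apply: eq_bigr => Q _.
  case: ifPn => // nQ; rewrite (d1_0 _ _ (_ : ~~ cov P Q)) ?linear0 //.
  by apply: contra nQ => /cov_le; apply: le_trans.
rewrite (bigD1 S) //= big1 ?addr0 // => S' /andP[SgS' S'S].
have [hS'|nS'] := boolP (h S'); last by rewrite t0 // linear0.
rewrite d1_0 //; apply: contra S'S => S'V.
by apply/eqP/(hyp_inj hypH nV).
Qed.
End Row.

(** * Exactness of the columns *)

Section Column.
Variable m : pred T.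
Hypothesis hypM : hyperplane m.

(* The last two conditions on the hyperplane h express that it is in another
   connected component of the arrangement of the hyperplanes containing Q
   than m. *)
Definition split_row (Q : T) : Prop := exists h : pred T,
  [/\ hyperplane h, h Q, forall R, le Q R -> h R -> row_exact R,
      forall S, cov Q S -> m S || h S &
      forall R, le Q R -> ~~ h R -> ~~ m R ->
        forall S, cov S R -> h S -> ~~ m S].

(** Dual to [restriction_surj] and [restriction_inj]: together with [extension_inj], it says that
    d'' is an isomorphism onto A^P from the sum of the A^S with S not in [m]. *)
Definition extension_surj P : Prop := forall a x, x \in U a P ->
  exists2 y : T -> W, forall S, y S \in U a S &
    x = \sum_(S | ~~ m S) D2 a P S (y S).

Definition extension_inj P : Prop := forall a (y : T -> W),
  (forall S, y S \in U a S) -> \sum_(S | ~~ m S) D2 a P S (y S) = 0 ->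
  forall S, cov P S -> ~~ m S -> y S = 0.

(** An element of A^P is known by its restriction off [h], and the strata Q not in [h] are in [m].
    Commuting d' with d'' thus reduces both claims at [P] to the same claims at such Q. *)
Let extension_split P : m P -> split_row P ->
  (forall Q, cov P Q -> m Q -> extension_surj Q /\ extension_inj Q) ->
  extension_surj P /\ extension_inj P.
Proof.
move=> mP [h [hypH hP rowP mhP Ph]] IH.
have mcov Q : cov P Q -> ~~ h Q -> m Q.
  by move=> PQ nQ; have := mhP Q PQ; rewrite (negPf nQ) orbF.
have rowS S : le P S -> forall Q, le S Q -> h Q -> row_exact Q.
  by move=> PS Q SQ; apply/rowP/(le_trans PS).
split.
  case=> [|a] x xU.
    exists (fun=> 0) => [S|]; first exact: mem0v.
    by rewrite (U0 xU) big1 // => *; rewrite linear0.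
  have /choice[w wP] : forall Q, exists f : T -> W, (forall R, f R \in U a R) /\
      (cov P Q -> m Q -> D1 a.+1 P Q x = \sum_(R | ~~ m R) D2 a Q R (f R)).
    move=> Q; have [/andP[PQ mQ]|nQ] := boolP (cov P Q && m Q); last first.
      exists (fun=> 0); split=> [R|PQ mQ]; first exact: mem0v.
      by rewrite PQ mQ in nQ.
    have [surj _] := IH Q PQ mQ.
    by have [f fU fE] := surj a _ (d1_in _ xU); exists f.
  (* For R not in [m] the sum has at most one term, Q = R \cap m. It glues the solutions at the
     various Q into one family, which is lifted to the strata in [h] by [restriction_surj]. *)
  pose w' R := \sum_(Q | [&& cov P Q, ~~ h Q & cov Q R]) w Q R.
  have w'U R : w' R \in U a R.
    by apply: memv_suml => Q _; have [] := wP Q.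
  have /choice[u uP] : forall S, exists v, v \in U a.+1 S /\ (cov P S -> h S ->
      forall R, cov S R -> ~~ h R -> D1 a.+1 S R v = w' R).
    move=> S; have [/andP[PS hS]|nS] := boolP (cov P S && h S); last first.
      by exists 0; rewrite mem0v; split=> // PS hS; rewrite PS hS in nS.
    have [v vU vE] := restriction_surj hypH hS (rowS S (cov_le PS)) w'U.
    by exists v.
  have uU S : u S \in U a.+1 S by have [] := uP S.
  exists u => //; apply/eqP; rewrite -subr_eq0; apply/eqP.
  apply: (restriction_inj hypH hP rowP (a := a.+1)) => [|Q PQ nQ].
    by rewrite memvB // memv_suml // => S _; apply: d2_in.
  have mQ := mcov Q PQ nQ.
  apply/eqP; rewrite linearB subr_eq0 /=; apply/eqP.
  rewrite ((wP Q).2 PQ mQ) linear_sum /=.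
  transitivity (\sum_(S | ~~ m S && cov P S)
      \sum_V D2 a Q V (D1 a.+1 S V (u S))); last first.
    rewrite big_mkcondr; apply: eq_bigr => S _; case: ifPn => [PS|nPS].
      by rewrite (os_d1d2 H).
    by rewrite d2_0 // linear0.
  rewrite exchange_big big_mkcond; apply: eq_bigr => V _ /=.
  have [QV|nQV] := boolP (cov Q V); last first.
    rewrite (d2_0 _ _ nQV) if_same big1 // => *; exact: d2_0.
  have nV : ~~ h V by apply: contra nQ; apply: (hyp_le hypH (cov_le QV)).
  case: ifPn => [nmV|]; last first.
    rewrite negbK => mV; rewrite big1 // => S /andP[nmS _].
    rewrite d1_0 ?linear0 //; apply: contra nmS => /cov_le SV.
    exact: (hyp_le hypM SV mV).
  have PV := le_trans (cov_le PQ) (cov_le QV).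
  have rP : rk P = (rk V).+2 by have := cov_rk PQ; have := cov_rk QV; lia.
  have [S [hS SV PS]] := hyp_meet hypH nV hP PV.
  have {}PS := cov2 SV PS rP.
  have nmS : ~~ m S by exact: (Ph V PV nV nmV S SV hS).
  rewrite (bigD1 S) /= ?nmS // big1 ?addr0 => [|R /andP[/andP[nmR PR] RS]].
    rewrite ((uP S).2 PS hS V SV nV) /w' (bigD1 Q) ?PQ ?nQ //= big1 ?addr0 //.
    move=> R /andP[/and3P[PR nR RV] RQ]; case/eqP: RQ.
    by apply: (hyp_inj hypM nmV) => //; apply: mcov.
  rewrite d1_0 ?linear0 //; apply: contra RS => RV.
  have hR : h R by have := mhP R PR; rewrite (negPf nmR).
  exact/eqP/(hyp_inj hypH nV).
move=> a y yU y0 S PS nmS.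
have hS : h S by have := mhP S PS; rewrite (negPf nmS).
apply: (restriction_inj hypH hS (rowS S (cov_le PS)) (a := a)) => // V SV nV.
have nmV : ~~ m V by apply: contra nmS; apply: (hyp_le hypM (cov_le SV)).
have PV := le_trans (cov_le PS) (cov_le SV).
have rP : rk P = (rk V).+2 by have := cov_rk PS; have := cov_rk SV; lia.
have [Q [mQ QV PQ]] := hyp_meet hypM nmV mP PV.
have {}PQ := cov2 QV PQ rP.
have nQ : ~~ h Q.
  apply/negP => hQ; have := Ph V PV nV nmV Q QV hQ.
  by rewrite mQ.
have [_ inj] := IH Q PQ mQ.
(* Applying d' towards Q to the relation d''y = 0 gives d''f = 0 at Q, so injectivity at Q yields f
   = 0 off [m]. *)
pose f V' := \sum_(R | ~~ m R && cov P R) D1 a R V' (y R).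
have fU V' : f V' \in U a.-1 V' by apply: memv_suml => R _; apply: d1_in.
have <- : f V = D1 a S V (y S).
  rewrite /f (bigD1 S) /= ?nmS // big1 ?addr0 // => R /andP[/andP[nmR PR] RS].
  rewrite d1_0 //; apply: contra RS => RV.
  have hR : h R by have := mhP R PR; rewrite (negPf nmR).
  exact/eqP/(hyp_inj hypH nV).
apply: (inj _ _ fU) => //.
transitivity (D1 a P Q (\sum_(R | ~~ m R) D2 a P R (y R))); last first.
  by rewrite y0 linear0.
rewrite linear_sum [RHS](bigID (cov P)) /= [X in _ + X]big1 ?addr0; last first.
  by move=> R /andP[_ nPR]; rewrite d2_0 // linear0.
transitivity (\sum_(R | ~~ m R && cov P R) \sum_V D2 a.-1 Q V (D1 a R V (y R))).
  rewrite exchange_big big_mkcond /=; apply: eq_bigr => R _.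
  case: ifPn => [nmR|]; first by rewrite linear_sum.
  rewrite negbK => mR; rewrite big1 // => R' /andP[nmR' _].
  rewrite d1_0 ?linear0 //; apply: contra nmR' => /cov_le R'R.
  exact: (hyp_le hypM R'R mR).
by apply: eq_bigr => R /andP[_ PR]; rewrite (os_d1d2 H).
Qed.

(** Surjectivity: a preimage under d'' exists by exactness and is moved off [m]. Injectivity: y =
    d''z by exactness, with z moved off [m]; injectivity at V \cap m then forces z to vanish at
    every V that contributes to y. *)
Let extension_col P : m P -> col_exact P ->
  (forall Q, le P Q -> (rk Q < rk P)%N -> m Q ->
     extension_surj Q /\ extension_inj Q) ->
  extension_surj P /\ extension_inj P.
Proof.
move=> mP [surj inj] IH.
(* A correction by d''d'' removes the components in m. *)
have remove a (z : T -> W) (A : pred T) : (forall V, z V \in U a V) ->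
    (forall V, A V -> [&& m V, le P V & (rk V < rk P)%N]) ->
    exists z' : T -> W, [/\ forall V, z' V \in U a V,
      forall S, \sum_V D2 a S V (z V) = \sum_V D2 a S V (z' V) &
      forall V, A V -> z' V = 0].
  move=> zU AP.
  have /choice[w wP] : forall V, exists f : T -> W, (forall X, f X \in U a X) /\
      (A V -> z V = \sum_(X | ~~ m X) D2 a V X (f X)).
    move=> V; have [AV|nAV] := boolP (A V); last first.
      by exists (fun=> 0); split=> // X; apply: mem0v.
    have /and3P[mV PV rV] := AP V AV; have [surjV _] := IH V PV rV mV.
    by have [f fU fE] := surjV a _ (zU V); exists f.
  exists (fun V => z V -
    \sum_(V' | A V') \sum_(X | ~~ m X && cov V' X) D2 a V X (w V' X)); split.
  - move=> V; rewrite memvB // memv_suml // => V' _; rewrite memv_suml // => X _.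
    by apply: d2_in; have [] := wP V'.
  - move=> S; under [RHS]eq_bigr do rewrite linearB linear_sum.
    rewrite sumrB [X in _ - X]exchange_big [X in _ - X]big1 ?subr0 //= => V' _.
    under eq_bigr do rewrite linear_sum.
    rewrite exchange_big big1 //= => X _; apply: d2d2.
    by have [] := wP V'.
  - move=> V AV; have /and3P[mV _ _] := AP V AV.
    apply/eqP; rewrite subr_eq0 {1}((wP V).2 AV) [eqbRHS](bigD1 V) //=.
    rewrite [X in _ + X]big1 ?addr0 => [|V' /andP[AV' V'V]].
      apply/eqP; rewrite big_mkcondr; apply: eq_bigr => X _.
      by case: ifPn => // nVX; rewrite d2_0.
    rewrite big1 // => X /andP[nX V'X]; rewrite d2_0 //.
    have /and3P[mV' _ _] := AP V' AV'.
    by apply: contra V'V => VX; apply/eqP/(hyp_inj hypM nX).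
split=> [a x xU|a y yU y0 S PS nmS].
  have [y yU yE] := surj a x xU.
  have [|z [zU zE z0]] := remove a y (fun Q => m Q && cov P Q) yU.
    by move=> V /andP[-> PV]; rewrite cov_le //=; have := cov_rk PV; lia.
  exists z => //; rewrite yE zE [RHS]big_mkcond; apply: eq_bigr => Q _.
  case: ifPn; rewrite // negbK => mQ.
  have [PQ|nPQ] := boolP (cov P Q); last exact: d2_0.
  by rewrite z0 ?linear0 ?mQ.
have [||z zU zE] := inj a (fun S => if m S then 0 else y S).
- by move=> Q; case: ifP; rewrite ?mem0v.
- rewrite -[RHS]y0 [RHS]big_mkcond; apply: eq_bigr => Q _.
  by case: ifP => _; rewrite ?linear0.
have [|z' [z'U z'E z'0]] :=
    remove a z (fun V => [&& m V, le P V & (rk V < rk P)%N]) zU.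
  by [].
have lt2 Q V : cov P Q -> cov Q V -> le P V && (rk V < rk P)%N.
  move=> PQ QV; rewrite (le_trans (cov_le PQ) (cov_le QV)) /=.
  by have := cov_rk PQ; have := cov_rk QV; lia.
(* The family extended by zero on [m] is d''z', so d''z' = 0 at Q in [m]. *)
have z'Q Q V : cov P Q -> m Q -> cov Q V -> ~~ m V -> z' V = 0.
  move=> PQ mQ; have rQ : (rk Q < rk P)%N by have := cov_rk PQ; lia.
  have [_ injQ] := IH Q (cov_le PQ) rQ mQ; apply: injQ z'U _ V.
  have := zE Q PQ; rewrite mQ z'E => z'Q0.
  rewrite [RHS]z'Q0 [LHS]big_mkcond; apply: eq_bigr => X _.
  case: ifPn; rewrite // negbK => mX.
  have [QX|nQX] := boolP (cov Q X); last by rewrite d2_0.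
  by rewrite z'0 ?linear0 // mX; apply: lt2 QX.
have := zE S PS; rewrite (negPf nmS) z'E => ->; rewrite big1 // => V _.
have [SV|nSV] := boolP (cov S V); last exact: d2_0.
have [mV|nV] := boolP (m V); first by rewrite z'0 ?linear0 // mV; apply: lt2 SV.
have PV := le_trans (cov_le PS) (cov_le SV).
have rP : rk P = (rk V).+2 by have := cov_rk PS; have := cov_rk SV; lia.
have [Q [mQ QV PQ]] := hyp_meet hypM nV mP PV.
by rewrite (z'Q Q V) ?linear0 //; exact: (cov2 QV PQ rP).
Qed.

Lemma extension_bij P : m P ->
  (forall Q, le P Q -> m Q -> col_exact Q \/ split_row Q) ->
  extension_surj P /\ extension_inj P.
Proof.
have [k] := ubnP (rk P); elim: k P => // k IHk P rP mP colP.
have IH Q : le P Q -> (rk Q < rk P)%N -> m Q ->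
    extension_surj Q /\ extension_inj Q.
  move=> PQ rQ mQ; apply: IHk => // [|R QR]; first by lia.
  by apply/colP/(le_trans PQ).
have [colE|rowE] := colP P (le_refl P) mP; first exact: extension_col.
apply: extension_split => // Q PQ; apply: IH (cov_le PQ) _.
by rewrite (cov_rk PQ).
Qed.

(** Dual to [row_exact_above]: z lives off [m], its value at S being read off from y at S \cap m.
    Then y - d''z vanishes on [m], and off [m] by [extension_inj]. *)
Lemma col_exact_above Sg : m Sg ->
  (forall Q, le Sg Q -> m Q -> col_exact Q \/ split_row Q) ->
  forall a (y : T -> W), (forall S, y S \in U a S) ->
    (forall P, le Sg P -> \sum_S D2 a P S (y S) = 0) ->
    exists2 z : T -> W, forall V, z V \in U a V &
      forall S, le Sg S -> y S = \sum_V D2 a S V (z V).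
Proof.
move=> mSg colS a y yU y0.
have ext P : le Sg P -> m P -> extension_surj P /\ extension_inj P.
  move=> SgP mP; apply: extension_bij => // Q PQ.
  by apply/colS/(le_trans SgP).
have /choice[w wP] : forall P, exists f : T -> W, (forall S, f S \in U a S) /\
    (le Sg P -> m P -> y P = \sum_(S | ~~ m S) D2 a P S (f S)).
  move=> P; have [/andP[SgP mP]|nP] := boolP (le Sg P && m P); last first.
    exists (fun=> 0); split=> [S|SgP mP]; first exact: mem0v.
    by rewrite SgP mP in nP.
  have [surj _] := ext P SgP mP.
  by have [f fU fE] := surj a _ (yU P); exists f.
pose z S := if m S then 0 else \sum_(P | [&& m P, le Sg P & cov P S]) w P S.
have zU S : z S \in U a S.
  rewrite /z; case: ifP => _; first exact: mem0v.
  by apply: memv_suml => P _; have [] := wP P.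
exists z => // S SgS.
pose t V := y V - \sum_S D2 a V S (z S).
suff tS : t S = 0 by apply/eqP; rewrite -subr_eq0; apply/eqP.
have tU V : t V \in U a V.
  by rewrite memvB // memv_suml // => X _; apply: d2_in.
have t0 P : m P -> le Sg P -> t P = 0.
  move=> mP SgP; apply/eqP; rewrite subr_eq0 ((wP P).2 SgP mP); apply/eqP.
  rewrite big_mkcond; apply: eq_bigr => X _; rewrite /z.
  case: ifPn => [nX|]; last by rewrite negbK => ->; rewrite linear0.
  rewrite (negPf nX); have [PX|nPX] := boolP (cov P X); last by rewrite !d2_0.
  rewrite (bigD1 P) ?mP ?SgP //= big1 ?addr0 // => Q.
  move=> /andP[/and3P[mQ _ QX] QP]; case/eqP: QP.
  exact: (hyp_inj hypM nX).
have [mS|nS] := boolP (m S); first exact: t0.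
have [P [mP PS SgP]] := hyp_meet hypM nS mSg SgS.
have [_ inj] := ext P SgP mP; apply: (inj a t) => //.
transitivity (\sum_X D2 a P X (t X)).
  rewrite big_mkcond; apply: eq_bigr => X _.
  case: ifPn; rewrite // negbK => mX.
  have [PX|nPX] := boolP (cov P X); last by rewrite d2_0.
  by rewrite t0 ?linear0 //; apply: le_trans (cov_le PX).
under eq_bigr do rewrite linearB linear_sum.
rewrite sumrB y0 // sub0r exchange_big big1 ?oppr0 //= => V _.
exact: d2d2.
Qed.
End Column.
End Exactness.

(** * Strata of a bi-arrangement *)

Section Codimension.
Variables (K : fieldType) (V : vectType K).
Implicit Types (S X : {vspace V}) (f : 'Hom(V, K^o)).

Lemma codimK S : (codim S + \dim S)%N = \dim {:V}.
Proof. by rewrite subnK // dimvS ?subvf. Qed.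

Lemma codim_lker S f : ~~ (S <= lker f)%VS ->
  codim (S :&: lker f) = (codim S).+1.
Proof.
move=> nS; have := limg_ker_dim f S.
have /eqP : (\dim (f @: S) == 1)%N.
  rewrite eqn_leq; apply/andP; split.
    by rewrite (leq_trans (dimvS (subvf _))) // dimvf.
  rewrite lt0n dimv_eq0; apply: contra nS => /eqP fS0.
  apply/subvP => v vS; rewrite memv_ker -memv0 -fS0.
  exact: memv_img.
by have := codimK S; have := codimK (S :&: lker f); lia.
Qed.

Lemma codim_leif S X : (S <= X)%VS -> codim S = codim X -> S = X.
Proof.
move=> SX eSX; apply/eqP; rewrite -(dimv_leqif_eq SX); apply/eqP.
by have := codimK S; have := codimK X; lia.
Qed.

End Codimension.

Section Strata.
Variables (K : fieldType) (V : vectType K) (I J : finType).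
Variables (L : I -> 'Hom(V, K^o)) (M : J -> 'Hom(V, K^o)).

Local Notation T := (stratum L M).
Local Coercion stratum_space : stratum >-> space.

Lemma interL_setU A B : interL L (A :|: B) = (interL L A :&: interL L B)%VS.
Proof.
apply/vspaceP => v; rewrite memv_cap !memvE /interL.
apply/subv_bigcapP/andP => [AB|[/subv_bigcapP vA /subv_bigcapP vB] i].
  by split; apply/subv_bigcapP => i iX; apply: AB; rewrite inE iX ?orbT.
by rewrite inE => /orP[/vA|/vB].
Qed.

Lemma interM_setU A B : interM M (A :|: B) = (interM M A :&: interM M B)%VS.
Proof.
apply/vspaceP => v; rewrite memv_cap !memvE /interM.
apply/subv_bigcapP/andP => [AB|[/subv_bigcapP vA /subv_bigcapP vB] i].
  by split; apply/subv_bigcapP => i iX; apply: AB; rewrite inE iX ?orbT.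
by rewrite inE => /orP[/vA|/vB].
Qed.

Lemma inter_in A B : inter L M A B \in strata L M.
Proof. by apply/imageP; exists (A, B). Qed.

Lemma stratumP (S : T) : exists A B, stratum_space S = inter L M A B.
Proof. by have /imageP[[A B] _ eS] := ssvalP S; exists A, B. Qed.

Lemma strata_cap (S S' : T) : (S :&: S')%VS \in strata L M.
Proof.
have [A [B ->]] := stratumP S; have [A' [B' ->]] := stratumP S'.
have -> : (inter L M A B :&: inter L M A' B')%VS = inter L M (A :|: A') (B :|: B').
  by apply/vspaceP => v; rewrite /inter interL_setU interM_setU !memv_cap andbACA.
exact: inter_in.
Qed.

Lemma lkerL_in i : lker (L i) \in strata L M.
Proof.
have -> : lker (L i) = inter L M [set i] set0.
  by rewrite /inter /interL /interM big_set1 big_set0 capvf.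
exact: inter_in.
Qed.

Lemma lkerM_in j : lker (M j) \in strata L M.
Proof.
have -> : lker (M j) = inter L M set0 [set j].
  by rewrite /inter /interL /interM big_set1 big_set0 capfv.
exact: inter_in.
Qed.

Definition stratum_le : rel T := fun S S' => (S <= S')%VS.
Local Notation rk := (fun S : T => codim S).
Local Notation cov := (covers rk stratum_le).

Lemma stratum_le_refl : reflexive stratum_le.
Proof. by move=> S; apply: subvv. Qed.

Lemma stratum_le_trans : transitive stratum_le.
Proof. by move=> Y X Z; apply: subv_trans. Qed.

Lemma stratum_le_anti : antisymmetric stratum_le.
Proof.
by move=> X Y XY; apply/val_inj/eqP; rewrite eqEsubv.
Qed.

Lemma cov_codim (P S : T) : cov P S -> codim P = (codim S).+1.
Proof. by case/andP => _ /eqP. Qed.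

Lemma cov_sub (P S : T) : cov P S -> (P <= S)%VS.
Proof. by case/andP. Qed.

Lemma cap_covers (P S S' : T) : S != S' -> cov P S -> cov P S' ->
  stratum_space P = (S :&: S')%VS.
Proof.
move=> ne PS PS'; apply: codim_leif; first by rewrite subv_cap !cov_sub.
have rS : codim S = codim S'.
  by have := cov_codim PS; have := cov_codim PS'; lia.
have PSS : (P <= S :&: S')%VS by rewrite subv_cap !cov_sub.
have ltS : (\dim (S :&: S') < \dim S)%N.
  rewrite ltn_neqAle dimvS ?capvSl // andbT; apply: contra ne => /eqP dS.
  have SS' : (S <= S')%VS.
    rewrite -(_ : (S :&: S')%VS = S) ?capvSr //; apply: codim_leif (capvSl _ _) _.
    by rewrite /codim dS.
  by apply/eqP/val_inj/codim_leif.
have := dimvS PSS; have := cov_codim PS.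
have := codimK P; have := codimK S; have := codimK (S :&: S'); lia.
Qed.

Lemma cov_glb (P Q S S' : T) : S != S' -> cov P S -> cov P S' ->
  stratum_le Q S -> stratum_le Q S' -> stratum_le Q P.
Proof.
move=> ne PS PS' QS QS'; rewrite /stratum_le (cap_covers ne PS PS').
by rewrite subv_cap; apply/andP.
Qed.

(** Two distinct subspaces of codimension 1 in X span X, so the dimension formula gives the
    codimension of their intersection. *)
Lemma cov_meet (S S' X : T) : cov S X -> cov S' X -> S != S' ->
  exists2 P : T, cov P S & cov P S'.
Proof.
move=> SX S'X ne; have rS : codim S = codim S'.
  by have := cov_codim SX; have := cov_codim S'X; lia.
have rP : codim (S :&: S') = (codim S).+1.
  have SS' : (S + S' <= X)%VS by rewrite subv_add !cov_sub.
  have ltS : (\dim S < \dim (S + S'))%N.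
    rewrite ltn_neqAle dimvS ?addvSl // andbT; apply: contra ne => /eqP dS.
    have -> // : S = S'; apply/esym/val_inj/codim_leif => //.
    rewrite [X in (_ <= X)%VS](_ : _ = (S + S')%VS) ?addvSr //.
    by apply: codim_leif (addvSl _ _) _; rewrite /codim dS.
  have := dimvS SS'; have := cov_codim SX; have := dimv_sum_cap S S'.
  by have := codimK S; have := codimK S'; have := codimK X;
    have := codimK (S :&: S'); lia.
exists (SeqSub (strata_cap S S')); rewrite /covers /stratum_le /=.
  by rewrite capvSl rP eqxx.
by rewrite capvSr rP rS eqxx.
Qed.

Lemma hyperplane_lker (f : 'Hom(V, K^o)) : lker f \in strata L M ->
  hyperplane rk stratum_le (fun S : T => (S <= lker f)%VS).
Proof.
move=> fst; have cap_f (X Q : T) : ~~ (X <= lker f)%VS -> (Q <= lker f)%VS ->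
    cov Q X -> stratum_space Q = (X :&: lker f)%VS.
  move=> nX Qf QX; apply: codim_leif; first by rewrite subv_cap cov_sub.
  by rewrite codim_lker // (cov_codim QX).
split=> [P S PS Sf|X Q R nX Qf Rf QX RX|X P nX Pf PX].
- exact: subv_trans PS Sf.
- by apply: val_inj; rewrite /= [LHS](cap_f X) // [RHS](cap_f X).
exists (SeqSub (strata_cap X (SeqSub fst))); split; rewrite /=.
- exact: capvSr.
- by rewrite /covers /stratum_le /= capvSl /stratum_space /= codim_lker.
- by rewrite /stratum_le /stratum_space /= subv_cap; apply/andP.
Qed.

End Strata.

(** * From the abstract bi-complex to a model of the Orlik-Solomon bi-complex *)

Section Realization.
Variables (K : fieldType) (V : vectType K) (I J : finType).
Variables (L : I -> 'Hom(V, K^o)) (M : J -> 'Hom(V, K^o)).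
Variable chi : {vspace V} -> color.

Local Notation T := (stratum L M).
Local Coercion stratum_space : stratum >-> space.
Local Notation rk := (fun S : T => codim S).
Local Notation cov := (covers rk (@stratum_le _ _ _ _ L M)).
Local Notation le := (@stratum_le _ _ _ _ L M).

Variables (W : vectType rat) (U : nat -> T -> {vspace W}).
Variables (D1 D2 : nat -> T -> T -> 'End(W)).
Hypothesis H : os_bicomplex rk le (fun S : T => chi S) U D1 D2 (\dim {:V}).+1.

Let d1_0 a P S v : ~~ cov P S -> D1 a P S v = 0.
Proof. by move=> nPS; rewrite (os_ncov1 H) // lfunE. Qed.

Let d2_0 a P S v : ~~ cov P S -> D2 a P S v = 0.
Proof. by move=> nPS; rewrite (os_ncov2 H) // lfunE. Qed.

Let codim_le (S : {vspace V}) : (codim S <= (\dim {:V}).+1)%N.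
Proof. by rewrite leqW // leq_subr. Qed.

(** The space does not depend on j, since only j = codim S - i is meaningful. *)
Definition realization : os_data L M := OSData
  (os_space := fun i j S => subvs_of (U i.+1 S))
  (fun i j S S' => linfun (vsproj (U i.+1 S') \o D1 i.+2 S S' \o vsval))
  (fun i j S S' => linfun (vsproj (U i.+1 S) \o D2 i.+1 S S' \o vsval)).

Local Notation family := (Defs.family realization).

Definition value i j (x : family i j) (S : T) : W := vsval (x S).

Lemma valueP i j (x : family i j) S : value x S \in U i.+1 S.
Proof. exact: subvsP. Qed.

Lemma value_inj i j (x y : family i j) S : value x S = value y S -> x S = y S.
Proof. exact: val_inj. Qed.

Lemma value_d1 Sg i j (x : family i.+1 j) S' :
  value (d1 Sg x) S' = \sum_(S | le Sg S) D1 i.+2 S S' (value x S).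
Proof.
rewrite /value /d1 linear_sum /= big_mkcondr; apply: eq_bigr => S _.
case: ifPn => [SS'|nSS']; last by rewrite d1_0.
by rewrite lfunE /= vsprojK //; apply: (os_in1 H); rewrite ?codim_le ?subvsP.
Qed.

Lemma value_d2 Sg i j (x : family i j) S : le Sg S ->
  value (d2 Sg x) S = \sum_S' D2 i.+1 S S' (value x S').
Proof.
move=> SgS; rewrite /value /d2 linear_sum /= big_mkcond; apply: eq_bigr => S' _.
have [SS'|nSS'] := boolP (cov S S'); last first.
  by rewrite (negPf (nSS' : ~~ codim1_incl _ _)) andbF d2_0.
have -> : (Sg <= S')%VS && codim1_incl S S'.
  by rewrite (subv_trans SgS (cov_sub SS')).
by rewrite lfunE /= vsprojK //; apply: (os_in2 H); rewrite ?codim_le ?subvsP.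
Qed.

Lemma realization_top (S : T) : stratum_space S = fullv ->
  exists f : 'Hom(os_space realization 0 0 S, rat^o), bijective f.
Proof.
move=> S_full; have dU : \dim (U 1 S) = 1%N.
  by apply: (os_top H); rewrite S_full /codim subnn.
pose e := vbasis (U 1 S); pose i0 := cast_ord (esym dU) (ord0 : 'I_1).
have UE v : v \in U 1 S -> v = coord e i0 v *: e`_i0.
  move=> vU; rewrite {1}(coord_vbasis vU) (bigD1 i0) //= big1 ?addr0 // => i.
  case/eqP; apply/val_inj => /=; have := ltn_ord i; have := ltn_ord i0.
  by rewrite {2 4}dU; lia.
have [f fE] : exists f : 'Hom(subvs_of (U 1 S), rat^o),
    f =1 fun x => coord e i0 (vsval x).
  by apply: linear_hom => k u v; rewrite !linearP.
have eU : e`_i0 \in U 1 S by rewrite vbasis_mem // mem_nth // size_tuple.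
exists f, (fun t => vsproj (U 1 S) (t *: e`_i0)) => x; rewrite fE /=.
  by apply: val_inj; rewrite /= vsprojK ?memvZ // -UE ?subvsP.
have e1 : coord e i0 e`_0 = 1.
  have := coord_free i0 i0 (basis_free (vbasisP (U 1 S))).
  by rewrite eqxx.
by rewrite vsprojK ?memvZ // linearZ /= e1 mulr1.
Qed.

Lemma realization_bicomplex Sg : is_bicomplex realization Sg.
Proof.
split=> i j x X /andP[SgX _]; apply: value_inj.
- rewrite value_d1 /value linear0.
  under eq_bigr => S SgS do rewrite -/(value _ _) value_d1 linear_sum.
  rewrite exchange_big big1 //= => S SgS.
  rewrite -[RHS](os_d1d1 H X (codim_le _) (valueP x S)) big_mkcond.
  apply: eq_bigr => S' _; case: ifPn => // nS'.
  have nSS' : ~~ cov S S' by apply: contra nS' => /cov_sub; apply: subv_trans.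
  by rewrite (d1_0 _ _ nSS') linear0.
- rewrite value_d2 // /value linear0.
  under eq_bigr => S _.
    have -> : D2 i.+1 X S (vsval (d2 Sg x S)) =
        D2 i.+1 X S (\sum_S' D2 i.+1 S S' (value x S')).
      have [XS|nXS] := boolP (cov X S); last by rewrite !(d2_0 _ _ nXS).
      by rewrite -(@value_d2 Sg) // /stratum_le (subv_trans SgX (cov_sub XS)).
    rewrite linear_sum /=.
    over.
  rewrite exchange_big big1 //= => S _.
  by apply: (os_d2d2 H) (valueP x S); apply: codim_le.
rewrite value_d1 value_d2 //.
transitivity (\sum_(S | le Sg S) d2d1 D1 D2 i.+2 X S (value x S)).
  transitivity (\sum_(P | le Sg P) \sum_S
     D1 i.+2 P X (D2 i.+2 P S (value x S))).
    by apply: eq_bigr => P SgP; rewrite value_d2 // linear_sum.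
  rewrite exchange_big [RHS]big_mkcond /=; apply: eq_bigr => S _.
  case: ifPn => [SgS|nS].
    apply: (d1d2_sum (@stratum_le_anti _ _ _ _ L M) (@cov_meet _ _ _ _ L M)
      (@cov_glb _ _ _ _ L M) H) => //; last exact: valueP.
    (* [d1d2_sum] requires a strict bound on the codimension, which is why the bi-complex is taken
       up to \dim V + 1. *)
    by rewrite ltnS leq_subr.
  rewrite big1 // => P SgP.
  have nPS : ~~ cov P S by apply: contra nS => /cov_sub; apply: subv_trans.
  by rewrite (d2_0 _ _ nPS) linear0.
rewrite /d2d1 exchange_big; apply: eq_bigr => S _ /=.
by rewrite value_d1 linear_sum.
Qed.

(** The abstract exactness lemmas see strata of every codimension, while a family in bidegree (i, j)
    is controlled only in codimension i + j; elsewhere it is replaced by zero. *)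
Let cut i j Sg r (x : family i j) (S : T) : W :=
  if in_range Sg r S then value x S else 0.

Let cutU i j Sg r (x : family i j) S : cut Sg r x S \in U i.+1 S.
Proof. by rewrite /cut; case: ifP => _; rewrite ?mem0v ?valueP. Qed.

Let lift i j (z : T -> W) : family i j := fun S => vsproj (U i.+1 S) (z S).

Let value_lift i j (z : T -> W) S : z S \in U i.+1 S ->
  value (lift i j z) S = z S.
Proof. exact: vsprojK. Qed.

Let eq_d1 Sg i j (x y : family i.+1 j) :
  eq_family Sg x y -> eq_family Sg (d1 Sg x) (d1 Sg y).
Proof.
move=> xy S' /andP[SgS' rS']; apply: eq_bigr => S /andP[SgS SS'].
by rewrite xy // /in_range SgS (cov_codim SS') //=; move/eqP: rS' => ->.
Qed.

Let eq_d2 Sg i j (x y : family i j) :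
  eq_family Sg x y -> eq_family Sg (d2 Sg x) (d2 Sg y).
Proof.
move=> xy S' /andP[SgS' rS']; apply: eq_bigr => S /andP[SgS SS'].
rewrite xy // /in_range SgS /=; apply/eqP.
by have := cov_codim SS'; move/eqP: rS' => ->; rewrite addnS => -[].
Qed.

Lemma realization_row Sg (h : pred T) : hyperplane rk le h -> h Sg ->
  (forall Q, le Sg Q -> h Q -> row_exact rk le U D1 Q) ->
  forall i j, row_exact_at realization Sg i j.
Proof.
move=> hypH hSg rowS i j x; split; last first.
  case=> y xy; case: i x y xy => //= i x y xy S SgS.
  rewrite (eq_d1 xy SgS).
  by have [dd _ _] := realization_bicomplex Sg; apply: dd.
move=> x0.
have [|z zU zE] := row_exact_above (@stratum_le_refl _ _ _ _ L M)
    (@stratum_le_trans _ _ _ _ L M) H (fun P : T => codim_le P) hypH hSg rowS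
    (cutU Sg (i + j) x).
  move=> X SgX; case: i x x0 => [|i] x x0.
    (* For i = 0 the cycle condition is void, and d' takes its values in the spaces of index 0,
       which are zero. *)
    apply/eqP; rewrite -memv0 -(os_0 H X) memv_suml // => S SgS.
    by apply: (os_in1 H (a := 1)); rewrite ?codim_le ?cutU.
  have [rX|rX] := eqVneq (codim (X : T)) (i + j)%N; last first.
    rewrite big1 // => S _; rewrite /cut; case: ifPn => [/andP[_ /eqP rS]|_].
      by rewrite d1_0 //; apply: contra rX => /cov_codim; rewrite rS => -[->].
    exact: linear0.
  have inX : in_range Sg (i + j) X by rewrite /in_range rX eqxx andbT.
  have := congr1 vsval (x0 X inX); rewrite -/(value _ _) value_d1 linear0 => xX.
  rewrite -[RHS]xX; apply: eq_bigr => S SgS; rewrite /cut.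
  case: ifPn => // nS; have nSX : ~~ cov S X; last by rewrite !(d1_0 _ _ nSX).
  apply: contra nS => /cov_codim rS.
  by apply/andP; split; rewrite // rS rX.
exists (lift i.+1 j z) => S SgS; apply: value_inj; rewrite value_d1.
have := zE S; rewrite /cut SgS => ->; last by case/andP: SgS.
by apply: eq_bigr => P _; rewrite value_lift.
Qed.

Lemma realization_col Sg (m : pred T) : hyperplane rk le m -> m Sg ->
  (forall Q, le Sg Q -> m Q ->
     col_exact rk le U D2 Q \/ split_row rk le U D1 m Q) ->
  forall i j, col_exact_at realization Sg i j.
Proof.
move=> hypM mSg colS i j x; split; last first.
  case: j x => [|j] x /=.
    by move=> /eq_d2 x0 S SgS; rewrite x0 // /d2 big1 // => *; rewrite linear0.
  case=> y xy S SgS; rewrite (eq_d2 xy SgS).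
  by have [_ dd _] := realization_bicomplex Sg; apply: dd.
move=> x0.
have [|z zU zE] := col_exact_above (@stratum_le_refl _ _ _ _ L M)
    (@stratum_le_trans _ _ _ _ L M) H (fun P : T => codim_le P) hypM mSg colS
    (cutU Sg (i + j) x).
  move=> P SgP; have [rP|rP] := eqVneq (codim (P : T)) (i + j.+1)%N; last first.
    rewrite big1 // => S _; rewrite /cut; case: ifPn => [/andP[_ /eqP rS]|_].
      by rewrite d2_0 //; apply: contra rP => /cov_codim; rewrite rS addnS => ->.
    exact: linear0.
  have inP : in_range Sg (i + j.+1) P by rewrite /in_range rP eqxx andbT.
  have := congr1 vsval (x0 P inP).
  rewrite -/(value _ _) value_d2 // linear0 => xP.
  rewrite -[RHS]xP; apply: eq_bigr => S _; rewrite /cut.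
  case: ifPn => // nS; have nPS : ~~ cov P S; last by rewrite !(d2_0 _ _ nPS).
  apply: contra nS => PS; rewrite /in_range (subv_trans SgP (cov_sub PS)) /=.
  by have := cov_codim PS; rewrite rP addnS => -[->].
case: j x x0 zE => [|j] x x0 zE /=.
  (* For j = 0 the boundaries must be zero: the primitive lies in spaces with i larger than the
     codimension, which vanish by [os_gt]. *)
  move=> S SgS; apply: value_inj; rewrite /value linear0.
  have := zE S; rewrite /cut SgS /value => ->; last by case/andP: SgS.
  rewrite big1 // => X _; have [SX|nSX] := boolP (cov S X); last exact: d2_0.
  suff -> : z X = 0 by rewrite linear0.
  apply/eqP; rewrite -memv0 -(os_gt H (a := i.+1) (S := X)) //.
  by case/andP: SgS => _ /eqP rS; have := cov_codim SX; rewrite rS; lia.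
exists (lift i j z) => S SgS; have leS : le Sg S by case/andP: SgS.
apply: value_inj; rewrite value_d2 //.
have := zE S leS; rewrite /cut SgS => ->.
by apply: eq_bigr => P _; rewrite value_lift.
Qed.

End Realization.

(** * A criterion for exactness in terms of the coloring *)

Section Exact.
Variables (K : fieldType) (V : vectType K) (I J : finType).
Variables (L : I -> 'Hom(V, K^o)) (M : J -> 'Hom(V, K^o)).
Variable chi : {vspace V} -> color.

Local Notation T := (stratum L M).
Local Coercion stratum_space : stratum >-> space.
Local Notation rk := (fun S : T => codim S).
Local Notation cov := (covers rk (@stratum_le _ _ _ _ L M)).

Definition lambda_hyperplane (S : T) (i : I) : Prop :=
  (S <= lker (L i))%VS /\
  forall Q : T, (S <= Q)%VS -> (Q <= lker (L i))%VS -> chi Q = Lambda.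

(** Color lambda on all strata between S and L_i makes their rows exact at the first two terms by
    construction, which is the input of [realization_row]. The conditions for color mu are those of
    [realization_col], with [split_row] given by some L_i. *)
Lemma exact_criterion :
  (forall i, L i != 0) -> (forall j, M j != 0) ->
  (forall S : T, strict S -> chi S = Lambda -> exists i, lambda_hyperplane S i) ->
  (forall S : T, strict S -> chi S = Mu -> exists2 j, (S <= lker (M j))%VS &
     forall Q : T, (S <= Q)%VS -> (Q <= lker (M j))%VS -> chi Q = Mu \/
       exists i, [/\ lambda_hyperplane Q i,
         forall S' : T, cov Q S' -> (S' <= lker (M j))%VS || (S' <= lker (L i))%VS &
         forall R : T, (Q <= R)%VS -> ~~ (R <= lker (L i))%VS ->
           ~~ (R <= lker (M j))%VS ->
           forall S' : T, cov S' R -> (S' <= lker (L i))%VS ->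
           ~~ (S' <= lker (M j))%VS]) ->
  exact L M chi.
Proof.
move=> L0 M0 rowH colH.
have [W [U [D1 [D2 H]]]] := os_bicomplex_exists rat (fun S : T => chi S)
   (@stratum_le_anti _ _ _ _ L M) (@stratum_le_trans _ _ _ _ L M)
   (@cov_meet _ _ _ _ L M) (@cov_glb _ _ _ _ L M) (\dim {:V}).+1.
(* [os_row] and [os_col] speak only of strict strata; those in a hyperplane are strict. *)
have pos (Q : T) f : f != 0 -> (Q <= lker f)%VS -> (0 < codim Q <= (\dim {:V}).+1)%N.
  move=> f0 Qf; rewrite leqW ?leq_subr // andbT lt0n.
  apply: contra f0 => /eqP rQ; apply/eqP/lfunP => v; rewrite lfunE /=.
  have /(_ v) := subvP Qf.
  rewrite (codim_leif (subvf Q)) ?memvf; last by rewrite rQ /codim subnn.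
  by rewrite memv_ker => /(_ isT)/eqP.
have rowL (S : T) i : lambda_hyperplane S i -> forall Q : T,
    (S <= Q)%VS -> (Q <= lker (L i))%VS -> row_exact rk (@stratum_le _ _ _ _ L M) U D1 Q.
  move=> [_ iS] Q SQ Qi; apply: (os_row H); last exact: iS.
  exact: pos (L0 i) Qi.
have exS : has_exact_rows_and_columns (realization U D1 D2) chi.
  move=> S i j sS _; split=> [/(rowH S sS)[k kS] a _|/(colH S sS)[k Sk kS] b _].
    apply: (realization_row H (hyperplane_lker (lkerL_in L M k))).
      by case: kS.
    exact: rowL kS.
  apply: (realization_col H (hyperplane_lker (lkerM_in L M k))) => // Q SQ Qk.
  have [chiQ|[l [lQ c1 c2]]] := kS Q SQ Qk.
    by left; apply: (os_col H) => //; apply: pos (M0 k) Qk.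
  right; exists (fun S' : T => (S' <= lker (L l))%VS); split=> //.
  - exact/hyperplane_lker/lkerL_in.
  - by case: lQ.
  - exact: rowL lQ.
(* The partial exactness that defines the Orlik-Solomon bi-complex is part of the full exactness
   [exS]. *)
exists (realization U D1 D2); split=> //; split.
- by move=> S; apply: (realization_top H).
- by move=> S; apply: (realization_bicomplex H).
- by move=> S i j sS rS chiS a /andP[ai _]; have [+ _] := exS S i j sS rS; apply.
- by move=> S i j sS rS chiS b /andP[bj _]; have [_ +] := exS S i j sS rS; apply.
Qed.
End Exact.

(** * Splittings of the arrangement at a stratum, and circuits *)

Section Membership.
Variables (K : fieldType) (V : vectType K) (I J : finType).
Variables (L : I -> 'Hom(V, K^o)) (M : J -> 'Hom(V, K^o)).
Local Coercion stratum_space : stratum >-> space.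

Lemma interMP (B : {set J}) v :
  reflect (forall j, j \in B -> M j v = 0) (v \in interM M B).
Proof.
rewrite memvE; apply: (iffP subv_bigcapP) => H j /H.
  by rewrite -memvE memv_ker => /eqP.
by move=> Mv; rewrite -memvE memv_ker Mv.
Qed.

Lemma interLP (A : {set I}) v :
  reflect (forall i, i \in A -> L i v = 0) (v \in interL L A).
Proof.
rewrite memvE; apply: (iffP subv_bigcapP) => H j /H.
  by rewrite -memvE memv_ker => /eqP.
by move=> Mv; rewrite -memvE memv_ker Mv.
Qed.

Lemma sub_lkerP (S : {vspace V}) (f : 'Hom(V, K^o)) :
  reflect (forall v, v \in S -> f v = 0) (S <= lker f)%VS.
Proof.
apply: (iffP subvP) => Sf v /Sf; first by rewrite memv_ker => /eqP.
by rewrite memv_ker => ->.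
Qed.

Lemma stratum_mem (S : stratum L M) v :
  (forall i, (S <= lker (L i))%VS -> L i v = 0) ->
  (forall j, (S <= lker (M j))%VS -> M j v = 0) -> v \in (S : {vspace V}).
Proof.
have [A [B ->]] := stratumP S => Lv Mv; rewrite memv_cap.
apply/andP; split.
  apply/interLP => i iA; apply/Lv/sub_lkerP => u /memv_capP[/interLP uA _].
  exact: uA.
apply/interMP => j jB; apply/Mv/sub_lkerP => u /memv_capP[_ /interMP uB].
exact: uB.
Qed.

Lemma cov_lker (f : 'Hom(V, K^o)) (Q X : stratum L M) :
  ~~ (X <= lker f)%VS -> (Q <= lker f)%VS ->
  covers (fun S : stratum L M => codim S) (@stratum_le _ _ _ _ L M) Q X ->
  stratum_space Q = (X :&: lker f)%VS.
Proof.
move=> nX Qf QX; apply: codim_leif; first by rewrite subv_cap cov_sub.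
by rewrite codim_lker // (cov_codim QX).
Qed.

(* The map tau splits the hyperplanes containing Q into two blocks in direct
   sum: the forms killed by tau and the forms invariant under tau. *)
Definition splits (Q : stratum L M) (tau : V -> V) : Prop :=
  (forall i, (Q <= lker (L i))%VS ->
     (forall v, L i (tau v) = 0) \/ (forall v, L i (tau v) = L i v)) /\
  (forall j, (Q <= lker (M j))%VS ->
     (forall v, M j (tau v) = 0) \/ (forall v, M j (tau v) = M j v)).

Lemma splits_mem (Q R : stratum L M) tau v : splits Q tau -> (Q <= R)%VS ->
  v \in (R : {vspace V}) ->
  tau v \in (R : {vspace V}) /\ v - tau v \in (R : {vspace V}).
Proof.
move=> [sL sM] QR vR; split; apply: stratum_mem => k /[dup] /sub_lkerP/(_ v vR) k0.
- by move=> /(subv_trans QR)/sL[]->.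
- by move=> /(subv_trans QR)/sM[]->.
- by move=> /(subv_trans QR)/sL[]e; rewrite linearB /= e k0 subrr.
- by move=> /(subv_trans QR)/sM[]e; rewrite linearB /= e k0 subrr.
Qed.

(** If S is not in M_j, then Q = S \cap M_j. For v in S, tau v is in S and in M_j, hence in Q and in
    L_i, and L_i has the same value at v and tau v. *)
Lemma splits_cover (Q : stratum L M) tau i j : splits Q tau ->
  (Q <= lker (L i))%VS -> (Q <= lker (M j))%VS ->
  (forall v, L i (tau v) = L i v) -> (forall v, M j (tau v) = 0) ->
  forall S : stratum L M,
  covers (fun S : stratum L M => codim S) (@stratum_le _ _ _ _ L M) Q S ->
  (S <= lker (M j))%VS || (S <= lker (L i))%VS.
Proof.
move=> sQ QL QM iE jE S QS; rewrite -implyNb; apply/implyP => nSj.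
apply/sub_lkerP => v vS; rewrite -iE.
have [tS _] := splits_mem sQ (cov_sub QS) vS.
by apply: (sub_lkerP _ _ QL);
   rewrite (cov_lker nSj QM QS) memv_cap tS memv_ker jE eqxx.
Qed.

(** Take v in R outside M_j. Then v - tau v is in R \cap L_i = S, and M_j has the same nonzero value
    there as at v. *)
Lemma splits_cap (Q : stratum L M) tau i j : splits Q tau ->
  (forall v, L i (tau v) = L i v) -> (forall v, M j (tau v) = 0) ->
  forall R : stratum L M, (Q <= R)%VS -> ~~ (R <= lker (L i))%VS ->
  ~~ (R <= lker (M j))%VS -> forall S : stratum L M,
  covers (fun S : stratum L M => codim S) (@stratum_le _ _ _ _ L M) S R ->
  (S <= lker (L i))%VS -> ~~ (S <= lker (M j))%VS.
Proof.
move=> sQ iE jE R QR nRi /subvPn[v vR]; rewrite memv_ker => Mv S SR Si.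
have [_ tR] := splits_mem sQ QR vR.
apply/subvPn; exists (v - tau v); last by rewrite memv_ker linearB /= jE subr0.
by rewrite (cov_lker nRi Si SR) memv_cap tR memv_ker linearB /= iE subrr eqxx.
Qed.

(** Circuits are connected: when the spans of two complementary parts are in direct sum, one part is
    dependent, hence is the whole circuit by minimality. *)
Lemma circuit_subset (A A1 : {set I}) (B B1 : {set J}) :
  circuit L M A B -> A1 \subset A -> B1 \subset B ->
  directv (<<[seq L i | i in A1] ++ [seq M j | j in B1]>> +
    <<[seq L i | i in (A :\: A1)%SET] ++ [seq M j | j in (B :\: B1)%SET]>>) ->
  (A1 = A /\ B1 = B) \/ (A1 = set0 /\ B1 = set0).
Proof.
have perm_split (X : finType) (C C1 : {set X}) : C1 \subset C ->
    perm_eq (enum C) (enum C1 ++ enum (C :\: C1)).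
  move=> sC; apply: uniq_perm; rewrite ?enum_uniq // ?cat_uniq ?enum_uniq.
    rewrite andbT /= -all_predC; apply/allP => x; rewrite mem_enum => /setDP[_ nx].
    by rewrite /= mem_enum.
  move=> x; rewrite mem_cat !mem_enum inE.
  by case: (boolP (x \in C1)) => //= xC1; rewrite (subsetP sC).
move=> [dep minAB] sA sB dir.
have [f1|] := boolP (free ([seq L i | i in A1] ++ [seq M j | j in B1])); last first.
  by move=> d1; left; apply: minAB.
right.
have nf2 : dependent L M (A :\: A1) (B :\: B1).
  apply: contra dep => f2.
  rewrite (@perm_free _ _ _ (([seq L i | i in A1] ++ [seq M j | j in B1]) ++
    ([seq L i | i in (A :\: A1)%SET] ++ [seq M j | j in (B :\: B1)%SET]))).
    by rewrite cat_free f1 f2.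
  rewrite perm_sym perm_catACA /image_mem -!map_cat perm_sym.
  by apply: perm_cat; apply: perm_map; apply: perm_split.
have [A2 B2] := minAB _ _ (subsetDl _ _) (subsetDl _ _) nf2.
split; apply/setP => x; rewrite inE; apply/negP => xX.
  by move: (subsetP sA x xX); rewrite -A2 inE xX.
by move: (subsetP sB x xX); rewrite -B2 inE xX.
Qed.

(** The forms of the circuit killed by tau and those fixed by tau have spans in direct sum. If j
    were in [B], all would be killed, as M_j is. Then tau would map everything into Q, hence into
    L_i, and L_i would be zero. *)
Lemma splits_circuit (Q : stratum L M) tau i j A B :
  splits Q tau -> (Q <= lker (L i))%VS -> L i != 0 -> M j != 0 ->
  (forall v, L i (tau v) = L i v) -> (forall v, M j (tau v) = 0) ->
  circuit L M A B -> stratum_space Q = inter L M A B -> j \notin B.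
Proof.
move=> [sL sM] QL Li0 Mj0 iE jE cAB QE; apply/negP => jB.
have QA k : k \in A -> (Q <= lker (L k))%VS.
  by move=> kA; apply/sub_lkerP => v; rewrite QE => /memv_capP[/interLP vA _]; apply: vA.
have QB k : k \in B -> (Q <= lker (M k))%VS.
  by move=> kB; apply/sub_lkerP => v; rewrite QE => /memv_capP[_ /interMP vB]; apply: vB.
pose A1 := [set k in A | `[< forall v, L k (tau v) = 0 >]].
pose B1 := [set k in B | `[< forall v, M k (tau v) = 0 >]].
have sA1 : A1 \subset A by apply/subsetP => k; rewrite inE => /andP[].
have sB1 : B1 \subset B by apply/subsetP => k; rewrite inE => /andP[].
have jB1 : j \in B1 by rewrite inE jB; apply/asboolP.
have kill f : f \in <<[seq L i | i in A1] ++ [seq M j | j in B1]>>%VS ->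
    forall v, f (tau v) = 0.
  have [||X XP] := @linear_vspace _ _ (fun f : 'Hom(V, K^o) => forall v, f (tau v) = 0).
  - by move=> v; rewrite lfunE.
  - by move=> a u w u0 w0 v; rewrite add_lfunE scale_lfunE u0 w0 scaler0 addr0.
  move=> fX; apply/XP; apply: subvP f fX; apply/span_subvP => g.
  rewrite mem_cat => /orP[] /imageP[k + ->]; rewrite inE => /andP[_ /asboolP k0];
  exact/XP.
have fix_ f : f \in <<[seq L i | i in (A :\: A1)%SET] ++
    [seq M j | j in (B :\: B1)%SET]>>%VS ->
    forall v, f (tau v) = f v.
  have [||X XP] := @linear_vspace _ _ (fun f : 'Hom(V, K^o) => forall v, f (tau v) = f v).
  - by move=> v; rewrite !lfunE.
  - by move=> a u w u0 w0 v; rewrite !add_lfunE !scale_lfunE u0 w0.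
  move=> fX; apply/XP; apply: subvP f fX; apply/span_subvP => g.
  rewrite mem_cat => /orP[] /imageP[k /setDP[kX k1] ->]; apply/XP.
    have [k0|//] := sL k (QA k kX).
    by case/negP: k1; rewrite inE kX; apply/asboolP.
  have [k0|//] := sM k (QB k kX).
  by case/negP: k1; rewrite inE kX; apply/asboolP.
have dir : directv (<<[seq L i | i in A1] ++ [seq M j | j in B1]>> +
    <<[seq L i | i in (A :\: A1)%SET] ++ [seq M j | j in (B :\: B1)%SET]>>).
  apply/directv_addP/eqP; rewrite -subv0; apply/subvP => f /memv_capP[f1 f2].
  rewrite memv0; apply/eqP/lfunP => v; rewrite lfunE /= -(fix_ f f2).
  exact: kill.
have [[eA eB]|[_ eB]] := circuit_subset cAB sA1 sB1 dir; last first.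
  by rewrite eB inE in jB1.
case/eqP: Li0; apply/lfunP => v; rewrite lfunE /= -iE.
apply: (sub_lkerP _ _ QL); rewrite QE memv_cap.
apply/andP; split; first apply/interLP; last apply/interMP.
  by move=> k; rewrite -eA inE => /andP[_ /asboolP].
by move=> k; rewrite -eB inE => /andP[_ /asboolP].
Qed.

End Membership.

(** * The multizeta bi-arrangement *)

Section MultizetaArrangement.
Variables (K : fieldType) (ns : seq nat).

Local Notation n := (sumn ns).
Local Notation V := 'rV[K]_n.+1.
Local Notation L := (multizeta_L K ns).
Local Notation M := (multizeta_M K ns).
Local Notation T := (stratum L M).
Local Notation chi := (complete_color Lambda (multizeta_color K ns)).
Local Coercion stratum_space : stratum >-> space.

Local Notation a k := ((nth 0%N (multizeta_word ns) k.-1)%:R : K).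

Hypothesis n_gt0 : (0 < n)%N.

(* The coordinates in the order 0, z_1, ..., z_n, z_0: the hyperplanes of M
   equate two consecutive ones. *)
Definition chain (v : V) (p : nat) : K :=
  if p == 0%N then 0 else if p == n.+1 then v ord0 ord0 else v ord0 (inord p).

(** Entry 0 of the row vector is z_0, which is at the last place n + 1 of the chain. *)
Definition of_chain (f : nat -> K) : V :=
  \row_(k < n.+1) f (if k == 0%N :> nat then n.+1 else k).

Lemma chain0 v : chain v 0 = 0.
Proof. by []. Qed.

Lemma of_chainK f p : f 0%N = 0 -> (p <= n.+1)%N -> chain (of_chain f) p = f p.
Proof.
move=> f0 pn; rewrite /chain; case: eqP => [->|p0]; first by rewrite f0.
case: eqP => [->|pn1]; rewrite mxE //= inordK; last by lia.
by case: eqP.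
Qed.

Lemma chainK v : of_chain (chain v) = v.
Proof.
apply/rowP => k; rewrite mxE; have kn := ltn_ord k.
case: (eqVneq (k : nat) 0%N) => k0; rewrite /chain /=.
  by rewrite eqxx; congr (v _ _); apply/val_inj.
by rewrite (negPf k0) (ltn_eqF kn) inord_val.
Qed.

Lemma chainL k u v p : chain (k *: u + v) p = k * chain u p + chain v p.
Proof.
rewrite /chain; case: ifP => _; first by rewrite mulr0 addr0.
by case: ifP => _; rewrite !mxE.
Qed.

Lemma chainB u v p : chain (u - v) p = chain u p - chain v p.
Proof. by rewrite -scaleN1r addrC chainL mulN1r addrC. Qed.

Lemma multizeta_LE (k : 'I_n.+1) v : L k v =
  if k == 0%N :> nat then chain v n.+1 else chain v k - a k * chain v n.+1.
Proof.
have z0 : zcoord K ns 0 v = chain v n.+1.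
  by rewrite zcoordE /chain eqxx /=; congr (v _ _); apply/val_inj; rewrite /= inordK.
rewrite /multizeta_L; case: eqP => [_|/eqP k0]; first exact: z0.
rewrite add_lfunE opp_lfunE scale_lfunE z0 zcoordE /chain (negPf k0).
by rewrite (_ : (k == n.+1 :> nat) = false) //; apply/eqP; have := ltn_ord k; lia.
Qed.

Lemma multizeta_ME (k : 'I_n.+1) v : M k v =
  if k == 0%N :> nat then chain v 1 else chain v k - chain v k.+1.
Proof.
have zE p : (0 < p <= n)%N -> zcoord K ns p v = chain v p.
  move=> pn; rewrite zcoordE /chain; case: eqP => [p0|_]; first by lia.
  by case: eqP => // p0; lia.
have z0 : zcoord K ns 0 v = chain v n.+1.
  by rewrite zcoordE /chain eqxx /=; congr (v _ _); apply/val_inj; rewrite /= inordK.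
have kn := ltn_ord k.
rewrite /multizeta_M; case: eqP => [_|k0]; first by apply: zE; lia.
case: eqP => [kN|kN]; rewrite add_lfunE opp_lfunE ?z0 ?zE ?kN //; try lia.
Qed.

Lemma multizeta_M_eq0 (k : 'I_n.+1) v : M k v = 0 <-> chain v k = chain v k.+1.
Proof.
rewrite multizeta_ME; case: eqP => [->|_]; first by rewrite chain0; split.
by split=> [/eqP|->]; [rewrite subr_eq0 => /eqP | rewrite subrr].
Qed.

Lemma eq_multizeta_M (k : 'I_n.+1) u v :
  chain u k = chain v k -> chain u k.+1 = chain v k.+1 -> M k u = M k v.
Proof. by rewrite !multizeta_ME; case: eqP => [->|_ -> ->]. Qed.

Lemma eq_multizeta_L (k : 'I_n.+1) u v :
  chain u k = chain v k -> chain u n.+1 = chain v n.+1 -> L k u = L k v.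
Proof. by rewrite !multizeta_LE => -> ->. Qed.

(** The chain jumps from 0 to 1 right after place j, so these vectors are, up to sign, the basis
    dual to the forms M_j. *)
Definition step (j : nat) : V := of_chain (fun p => (j < p)%N%:R).

Lemma chain_step j p : (p <= n.+1)%N -> chain (step j) p = (j < p)%N%:R.
Proof. by move=> pn; rewrite of_chainK. Qed.

Lemma M_step (k j : 'I_n.+1) : (M k (step j) == 0) = (k != j).
Proof.
have kn := ltn_ord k.
have -> : (M k (step j) == 0) = (chain (step j) k == chain (step j) k.+1).
  by apply/eqP/eqP => /multizeta_M_eq0.
rewrite !chain_step; try lia.
rewrite ltnS; case: (ltngtP j k) => [jk|kj|/val_inj->] /=.
- by rewrite eqxx neq_ltn jk orbT.
- by rewrite eqxx neq_ltn kj.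
- by rewrite eqxx eq_sym oner_eq0.
Qed.

Lemma M_eq0 v : (forall k, M k v = 0) -> v = 0.
Proof.
move=> Mv; have ch p : (p <= n.+1)%N -> chain v p = 0.
  elim: p => [|p IHp] pn; first exact: chain0.
  have := Mv (Ordinal (pn : p < n.+1)%N) => /multizeta_M_eq0/= <-.
  exact/IHp/ltnW.
rewrite -[v]chainK; apply/rowP => k; rewrite !mxE ch //.
by have := ltn_ord k; case: ifP => // _ /ltnW.
Qed.

Lemma step_interM (B : {set 'I_n.+1}) (j : 'I_n.+1) :
  (step j \in interM M B) = (j \notin B).
Proof.
apply/interMP/idP => [jB|jB k kB].
  by apply/negP => /jB/eqP; rewrite M_step eqxx.
by apply/eqP; rewrite M_step; apply: contraNneq jB => <-.
Qed.

Lemma interM_neq0 B : interM M B != 0%VS -> exists j, j \notin B.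
Proof.
move=> B0; apply/existsP; apply: contraNT B0; rewrite negb_exists => /forallP B1.
rewrite -subv0; apply/subvP => v /interMP vB; rewrite memv0; apply/eqP/M_eq0 => k.
by apply: vB; have := B1 k; rewrite negbK.
Qed.

Lemma chain_step_last (j : 'I_n.+1) : chain (step j) n.+1 = 1.
Proof. by rewrite chain_step // ltn_ord. Qed.

Lemma step_neq0 (j : 'I_n.+1) : step j != 0.
Proof.
by apply/eqP => /(congr1 (M j)) /eqP; rewrite linear0 M_step eqxx.
Qed.

Lemma chi_Mu (S : {vspace V}) :
  chi S = Mu <-> S <> 0%VS /\ exists B, S = interM M B.
Proof.
rewrite /complete_color /multizeta_color; case: (eqVneq S 0%VS) => S0.
  by split=> [|[]].
split=> [|[_ [B SB]]]; last by case: existsP => // -[]; exists B; apply/eqP.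
by case: existsP => // -[B /eqP SB] _; split; [apply/eqP | exists B].
Qed.

Lemma chi_Lambda (S : {vspace V}) :
  chi S = Lambda <-> S = 0%VS \/ forall B, S <> interM M B.
Proof.
rewrite /complete_color /multizeta_color; case: (eqVneq S 0%VS) => S0.
  by split=> // _; left.
split=> [|[/eqP|nB]]; last 2 first.
- by rewrite (negPf S0).
- by case: existsP => // -[B /eqP /nB].
by case: existsP => // nB _; right => B SB; apply: nB; exists B; apply/eqP.
Qed.

Definition mu_set (S : {vspace V}) : {set 'I_n.+1} :=
  [set j | (S <= lker (M j))%VS].

Lemma sub_mu_set (S : {vspace V}) : (S <= interM M (mu_set S))%VS.
Proof.
apply/subvP => v vS; apply/interMP => j; rewrite inE => /sub_lkerP; exact.
Qed.

Lemma interM_mu_set (S : {vspace V}) B :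
  (S <= interM M B)%VS -> (interM M (mu_set S) <= interM M B)%VS.
Proof.
move=> /subvP SB; apply/subvP => v /interMP vS; apply/interMP => j jB; apply: vS.
by rewrite inE; apply/sub_lkerP => u /SB/interMP; apply.
Qed.

(** Some j is not in [B], and [step j] belongs to the intersection with z_0 = 1. *)
Lemma interM_notin_L0 B : interM M B != 0%VS -> ~~ (interM M B <= lker (L ord0))%VS.
Proof.
move=> /interM_neq0[j jB]; apply/subvPn; exists (step j); first by rewrite step_interM.
by rewrite memv_ker multizeta_LE /= chain_step_last oner_eq0.
Qed.

Lemma lambda_hyperplane0 (S : T) : stratum_space S = 0%VS ->
  lambda_hyperplane chi S ord0.
Proof.
move=> S0; split=> [|Q _ QL]; first by rewrite S0 sub0v.
case chiQ: (chi Q) => //; have [/eqP Q0 [B QB]] := (chi_Mu Q).1 chiQ.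
by have := interM_notin_L0 (B := B); rewrite -QB Q0 QL => /(_ isT).
Qed.

(** The intersection of the M_j containing S is the smallest intersection of elements of M that
    contains S. The vector [v] in it and off L_i thus excludes color mu between S and L_i; it is
    returned for use in [mu_splittingI]. *)
Lemma lambda_hyperplane_ex (S : T) : stratum_space S <> 0%VS ->
  chi S = Lambda -> exists i v, [/\ lambda_hyperplane chi S i,
    v \in interM M (mu_set S) & L i v != 0].
Proof.
move=> S0 /chi_Lambda[//|nB].
have /subvPn[v vB vS] : ~~ (interM M (mu_set S) <= S)%VS.
  apply/negP => BS; apply: (nB (mu_set S)); apply/eqP.
  by rewrite eqEsubv sub_mu_set.
have [i Si Liv] : exists2 i, (S <= lker (L i))%VS & L i v != 0.
  apply: contrapT => ni; case/negP: vS; apply: stratum_mem => [i Si|j Sj].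
    by apply/eqP; apply: contraPT ni => Liv []; exists i.
  by apply: (interMP _ _ _ vB); rewrite inE.
exists i, v; split=> //; split=> // Q SQ Qi.
case chiQ: (chi Q) => //; have [_ [B QB]] := (chi_Mu Q).1 chiQ.
case/eqP: Liv; apply: (sub_lkerP _ _ Qi); rewrite QB.
by apply: subvP vB; apply: interM_mu_set; rewrite -QB.
Qed.

(** The common input of tameness, through [splits_circuit], and of exactness, through [splits_cover]
    and [splits_cap], at strata of color mu. *)
Definition mu_splitting (S : T) (j : 'I_n.+1) : Prop :=
  (S <= lker (M j))%VS /\
  forall Q : T, (S <= Q)%VS -> (Q <= lker (M j))%VS -> chi Q = Lambda ->
  exists i tau, [/\ lambda_hyperplane chi Q i, splits Q tau,
    forall v, L i (tau v) = L i v & forall v, M j (tau v) = 0].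

(** For Q of color lambda, [lambda_hyperplane_ex] gives L_i and v with L_i v nonzero. Since tau
    fixes v, it cannot kill L_i, so it fixes L_i. *)
Lemma mu_splittingI (S : T) j : stratum_space S <> 0%VS ->
  (S <= lker (M j))%VS ->
  (forall Q : T, (S <= Q)%VS -> (Q <= lker (M j))%VS -> exists tau,
    [/\ splits Q tau, forall v, M j (tau v) = 0 &
      forall v, v \in interM M (mu_set Q) -> tau v = v]) ->
  mu_splitting S j.
Proof.
move=> S0 Sj tauE; split=> // Q SQ Qj chiQ.
have Q0 : stratum_space Q <> 0%VS.
  by move=> Q0; apply: S0; apply/eqP; rewrite -subv0 -Q0.
have [i [v [iQ vQ Liv]]] := lambda_hyperplane_ex Q0 chiQ.
have [tau [sQ jtau fix_tau]] := tauE Q SQ Qj.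
exists i, tau; split=> //; case: (iQ) => Qi _.
have [tau0|//] := sQ.1 i Qi.
by case/eqP: Liv; rewrite -(fix_tau v vQ) tau0.
Qed.

(** Let c be least with Q not in M_c. The block is formed by the places up to c, which the M_k
    containing Q link to 0, and tau annihilates these coordinates. *)
Lemma mu_splitting_first (S : T) B : stratum_space S = interM M B ->
  stratum_space S <> 0%VS -> (S <= lker (M ord0))%VS -> mu_splitting S ord0.
Proof.
move=> SB S0 SM0; have [j jB] : exists j, j \notin B.
  by apply: interM_neq0; rewrite -SB; apply/eqP.
have jS : step j \in (S : {vspace V}) by rewrite SB step_interM.
apply: mu_splittingI => // Q SQ QM0.
have jQ := subvP SQ _ jS.
have cut_ex : exists c, (c <= n)%N && ~~ (Q <= lker (M (inord c)))%VS.
  exists j; rewrite -ltnS ltn_ord inord_val; apply/negP => /sub_lkerP/(_ _ jQ)/eqP.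
  by rewrite M_step eqxx.
have [c /andP[cn nMc] cmin] := ex_minnP cut_ex.
have c_gt0 : (0 < c)%N.
  by rewrite lt0n; apply: contraNneq nMc => ->; rewrite (_ : inord 0 = ord0) //;
     apply/val_inj; rewrite /= inordK.
have below (k : 'I_n.+1) : (k < c)%N -> (Q <= lker (M k))%VS.
  move=> kc; apply: contraLR kc => nk; rewrite -leqNgt; apply: cmin.
  by rewrite inord_val nk -ltnS ltn_ord.
have cj : (c <= j)%N.
  rewrite leqNgt; apply/negP => /below/sub_lkerP/(_ _ jQ)/eqP.
  by rewrite M_step eqxx.
pose tau v := of_chain (fun p => if (p <= c)%N then 0 else chain v p).
have tauE v p : (p <= n.+1)%N ->
    chain (tau v) p = if (p <= c)%N then 0 else chain v p.
  by move=> pn; rewrite of_chainK.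
have tau_last v : chain (tau v) n.+1 = chain v n.+1.
  by rewrite tauE // leqNgt ltnS cn.
exists tau; split=> [|v|v vQ].
- split=> k Qk; have kn := ltn_ord k; have kn' := ltnW kn.
    have [k0|k0] := eqVneq (k : nat) 0%N.
      by right=> v; rewrite !multizeta_LE k0 tau_last.
    have [kc|ck] := leqP k c; last first.
      right=> v; apply: eq_multizeta_L => //.
      by rewrite tauE // leqNgt ck.
    left=> v; rewrite multizeta_LE (negPf k0) tauE // kc.
    (* [step j] is in Q, with z_k = 0 and z_0 = 1. Hence a_k = 0, and L_k involves only the
       coordinate z_k of the block. *)
    have := sub_lkerP _ _ Qk _ jQ; rewrite multizeta_LE (negPf k0) chain_step_last.
    rewrite chain_step // ltnNge (leq_trans kc cj) /= mulr1 sub0r.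
    by move/eqP; rewrite oppr_eq0 => /eqP->; rewrite mul0r subrr.
  have kc : (k : nat) != c by apply: contraNneq nMc => <-; rewrite inord_val.
  case: (ltngtP k c) kc => // [kc|ck] _; [left|right] => v.
    by apply/multizeta_M_eq0; rewrite !tauE // kc (ltnW kc).
  by apply: eq_multizeta_M; rewrite tauE // leqNgt ?ltnS ?ck ?(ltnW ck).
- apply/multizeta_M_eq0; rewrite !tauE // c_gt0 //.
- have v0 p : (p <= c)%N -> chain v p = 0.
    elim: p => [|p IHp] pc //; rewrite -(IHp (ltnW pc)).
    have pn : (p < n.+1)%N by lia.
    apply/esym/(@multizeta_M_eq0 (Ordinal pn)).
    by apply: (interMP _ _ _ vQ); rewrite inE; apply: below.
  rewrite -[RHS]chainK; apply/rowP => k; rewrite !mxE.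
  by case: ifP => // pc; rewrite v0.
Qed.

(** The mirror image: d is the largest index with Q not in M_d, and tau replaces the coordinates
    after place d by z_0. *)
Lemma mu_splitting_last (S : T) B : stratum_space S = interM M B ->
  stratum_space S <> 0%VS -> (S <= lker (M ord_max))%VS -> mu_splitting S ord_max.
Proof.
move=> SB S0 SMn; have [j jB] : exists j, j \notin B.
  by apply: interM_neq0; rewrite -SB; apply/eqP.
have jS : step j \in (S : {vspace V}) by rewrite SB step_interM.
apply: mu_splittingI => // Q SQ QMn.
have jQ := subvP SQ _ jS.
have cut_ex : exists c, (c <= n)%N && ~~ (Q <= lker (M (inord c)))%VS.
  exists j; rewrite -ltnS ltn_ord inord_val; apply/negP => /sub_lkerP/(_ _ jQ)/eqP.
  by rewrite M_step eqxx.
have cut_le c : (c <= n)%N && ~~ (Q <= lker (M (inord c)))%VS -> (c <= n)%N.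
  by case/andP.
have [d /andP[dn nMd] dmax] := ex_maxnP cut_ex cut_le.
have d_lt : (d < n)%N.
  rewrite ltn_neqAle dn andbT; apply: contraNneq nMd => ->.
  by rewrite (_ : inord n = ord_max) //; apply/val_inj; rewrite /= inordK.
have above (k : 'I_n.+1) : (d < k)%N -> (Q <= lker (M k))%VS.
  move=> kd; apply: contraLR kd => nk; rewrite -leqNgt; apply: dmax.
  by rewrite inord_val nk -ltnS ltn_ord.
have jd : (j <= d)%N.
  rewrite leqNgt; apply/negP => /above/sub_lkerP/(_ _ jQ)/eqP.
  by rewrite M_step eqxx.
pose tau v := of_chain (fun p => if (d < p)%N then chain v n.+1 else chain v p).
have tauE v p : (p <= n.+1)%N ->
    chain (tau v) p = if (d < p)%N then chain v n.+1 else chain v p.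
  by move=> pn; rewrite of_chainK.
have tau_last v : chain (tau v) n.+1 = chain v n.+1 by rewrite tauE // if_same.
exists tau; split=> [|v|v vQ].
- split=> k Qk; have kn := ltn_ord k; have kn' := ltnW kn.
    have [k0|k0] := eqVneq (k : nat) 0%N.
      by right=> v; rewrite !multizeta_LE k0 tau_last.
    have [kd|dk] := leqP k d.
      right=> v; apply: eq_multizeta_L => //.
      by rewrite tauE // ltnNge kd.
    left=> v; rewrite multizeta_LE (negPf k0) tau_last tauE // dk.
    (* Now [step j] has z_k = z_0 = 1, so a_k = 1 and L_k compares two coordinates of the block. *)
    have := sub_lkerP _ _ Qk _ jQ; rewrite multizeta_LE (negPf k0) chain_step_last.
    rewrite chain_step // (leq_ltn_trans jd dk) /= mulr1.
    by move/eqP; rewrite subr_eq0 => /eqP<-; rewrite mul1r subrr.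
  have kd : (k : nat) != d by apply: contraNneq nMd => <-; rewrite inord_val.
  case: (ltngtP k d) kd => // [kd|dk] _; [right|left] => v.
    by apply: eq_multizeta_M; rewrite tauE // ltnNge ?kd ?(ltnW kd).
  by apply/multizeta_M_eq0; rewrite !tauE // ltnS dk (ltnW dk).
- by apply/multizeta_M_eq0; rewrite !tauE //= d_lt ltnS ltnW.
- have vn p : (d < p <= n.+1)%N -> chain v p = chain v n.+1.
    move=> dpn; rewrite -(subKn (proj2 (andP dpn))).
    have : (d < n.+1 - (n.+1 - p))%N by lia.
    elim: (_ - p)%N => [|m IHm] dm; first by rewrite subn0.
    rewrite -IHm; last by lia.
    have pn : (n.+1 - m.+1 < n.+1)%N by lia.
    have -> : (n.+1 - m)%N = (n.+1 - m.+1).+1 by lia.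
    apply: (multizeta_M_eq0 (Ordinal pn) v).1.
    by apply: (interMP _ _ _ vQ); rewrite inE; apply: above.
  rewrite -[RHS]chainK; apply/rowP => k; rewrite !mxE.
  set p := (if k == 0%N :> nat then _ else _); have pn : (p <= n.+1)%N.
    by have := ltn_ord k; rewrite /p; case: ifP => // _ /ltnW.
  by case: ifP => // dp; rewrite [RHS]vn // dp.
Qed.

(** No L_i contains S, so no stratum containing S has color lambda and the condition is empty. *)
Lemma mu_splitting_middle (S : T) B j : stratum_space S = interM M B ->
  stratum_space S <> 0%VS -> (S <= lker (M j))%VS ->
  ~~ (S <= lker (M ord0))%VS -> ~~ (S <= lker (M ord_max))%VS ->
  mu_splitting S j.
Proof.
move=> SB S0 Sj n0 nn; split=> // Q SQ Qj chiQ.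
have Q0 : stratum_space Q <> 0%VS.
  by move=> Q0; apply: S0; apply/eqP; rewrite -subv0 -Q0.
have [i [v [[Qi _] _ _]]] := lambda_hyperplane_ex Q0 chiQ.
have /sub_lkerP Si := subv_trans SQ Qi.
have notB k : ~~ (S <= lker (M k))%VS -> k \notin B.
  apply: contra => kB; apply/sub_lkerP => u; rewrite SB => /interMP; exact.
(* This vector has z_1 = ... = z_n = 1 and z_0 = 0, so it is off L_i for i > 0; [step ord_max] has
   z_0 = 1 and is off L_0. *)
have fS : step (ord0 : 'I_n.+1) - step (ord_max : 'I_n.+1) \in (S : {vspace V}).
  by rewrite SB memvB ?step_interM ?notB.
have gS : step (ord_max : 'I_n.+1) \in (S : {vspace V}) by rewrite SB step_interM notB.
have in0 := ltn_ord i; exfalso.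
have [i0|i0] := eqVneq (i : nat) 0%N.
  have := Si _ gS; rewrite multizeta_LE i0 chain_step_last => /eqP.
  by rewrite oner_eq0.
have := Si _ fS; rewrite multizeta_LE (negPf i0) !chainB !chain_step_last subrr.
rewrite mulr0 subr0 !chain_step ?(ltnW in0) //=.
have -> : (0 < i)%N by rewrite lt0n.
by rewrite ltnNge -ltnS in0 subr0 => /eqP; rewrite oner_eq0.
Qed.

Lemma mu_splitting_ex (S : T) : strict S -> chi S = Mu ->
  exists j, mu_splitting S j.
Proof.
move=> sS /chi_Mu[S0 [B SB]].
have [SM0|n0] := boolP (S <= lker (M ord0))%VS.
  by exists ord0; apply: mu_splitting_first SB S0 SM0.
have [SMn|nn] := boolP (S <= lker (M ord_max))%VS.
  by exists ord_max; apply: mu_splitting_last SB S0 SMn.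
have [j jB] : exists j, j \in B.
  apply/existsP; apply: contraNT sS; rewrite negb_exists => /forallP B0.
  rewrite SB /interM big_pred0 // => j; exact/negbTE/B0.
exists j; apply: (mu_splitting_middle SB S0 _ n0 nn).
by apply/sub_lkerP => u; rewrite SB => /interMP; apply.
Qed.
End MultizetaArrangement.

(** * Kunneth condition, tameness and exactness of the multizeta bi-arrangement *)

Section MultizetaTame.
Variables (K : fieldType) (ns : seq nat).

Local Notation n := (sumn ns).
Local Notation V := 'rV[K]_n.+1.
Local Notation L := (multizeta_L K ns).
Local Notation M := (multizeta_M K ns).
Local Notation T := (stratum L M).
Local Notation chi := (complete_color Lambda (multizeta_color K ns)).
Local Coercion stratum_space : stratum >-> space.

Local Notation a k := ((nth 0%N (multizeta_word ns) k.-1)%:R : K).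

Hypothesis n_gt0 : (0 < n)%N.

Local Notation dual j := ((M j (step K ns j))^-1 *: step K ns j).

Lemma M_dual (k j : 'I_n.+1) : M k (dual j) = (k == j)%:R.
Proof.
rewrite linearZ /=; have [->|kj] := eqVneq k j.
  have nz : M j (step K ns j) != 0 by rewrite M_step // eqxx.
  exact: mulVf nz.
have /eqP-> : M k (step K ns j) == 0 by rewrite M_step.
exact: scaler0.
Qed.

Lemma M_basis (v : V) : v = \sum_j M j v *: dual j.
Proof.
apply/eqP; rewrite -subr_eq0; apply/eqP; apply: M_eq0 => // k.
rewrite linearB linear_sum (bigD1 k) //= big1 ?addr0 => [|j jk].
  by rewrite linearZ /= M_dual eqxx [_ *: _]mulr1 subrr.
by rewrite linearZ /= M_dual eq_sym (negPf jk) scaler0.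
Qed.

Lemma ann_interM (B : {set 'I_n.+1}) (f : 'Hom(V, K^o)) :
  f \in ann (interM M B) -> f = \sum_(j in B) f (dual j) *: M j.
Proof.
move=> /annP fB; apply/lfunP => v; rewrite sum_lfunE {1}[v]M_basis linear_sum.
rewrite [RHS]big_mkcond; apply: eq_bigr => j _; rewrite linearZ /=.
case: ifPn => [_|jB]; first by rewrite scale_lfunE [LHS]mulrC.
by rewrite fB ?scaler0 // memvZ // step_interM.
Qed.

(** If S has color mu, so has S_1 ([muU]). If S_1 and S_2 have color mu, then S is an intersection
    of elements of M, so color lambda forces S = 0; then L_0 would contain S_1 or S_2. *)
Lemma multizeta_kunneth : kunneth L M chi.
Proof.
have muU (S S1 S2 : T) : decomposition S S1 S2 -> chi S = Mu ->
    chi S1 = Mu.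
  move=> [SE [annS dirS] _ decM] /chi_Mu[S0 [B SB]].
  apply/chi_Mu; split=> [S10|]; first by apply: S0; rewrite SE S10 cap0v.
  pose B1 := [set j in B | (S1 <= lker (M j))%VS].
  exists B1; apply/eqP; rewrite eqEsubv; apply/andP; split.
    apply/subvP => v vS; apply/interMP => j; rewrite inE => /andP[_ /sub_lkerP].
    exact.
  apply/subvP => v /interMP vB1.
  have ann1 f : f \in ann S1 -> f v = 0.
    move=> f1; have fS : f \in ann (interM M B).
      by rewrite -SB annS (subvP (addvSl _ _)).
    (* In the expansion of f in the M_j, the part on [B1] vanishes on S_1 and the rest on S_2. Then
       f - g vanishes on both, so f = g because the sum of annihilators is direct. *)
    pose g := \sum_(j in B1) f (dual j) *: M j.
    have g1 : g \in ann S1.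
      apply: memv_suml => j; rewrite inE => /andP[_ /sub_lkerP Sj].
      by rewrite memvZ //; apply/annP.
    have fg : f - g \in ann S2.
      have -> : f - g = \sum_(j in B :\: B1) f (dual j) *: M j.
        apply/eqP; rewrite subr_eq [X in X == _](ann_interM fS) (big_setID B1) /=.
        rewrite addrC /g; apply/eqP; congr (_ + _); apply: eq_bigl => j.
        by rewrite !inE; case: (j \in B).
      apply: memv_suml => j /setDP[jB jB1]; rewrite memvZ //; apply/annP.
      have Sj : (S <= lker (M j))%VS.
        by apply/sub_lkerP => u; rewrite SB => /interMP; apply.
      case: (decM j Sj) => [S1j|/sub_lkerP //].
      by rewrite inE jB S1j in jB1.
    have /eqP : f - g \in (ann S1 :&: ann S2)%VS.
      by rewrite memv_cap fg andbT memvB.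
    have /directv_addP-> := dirS; rewrite eqb_id memv0 subr_eq0 => /eqP->.
    by rewrite sum_lfunE big1 // => j jB1; rewrite scale_lfunE vB1 ?scaler0.
  apply: stratum_mem => k /sub_lkerP S1k; apply: ann1; exact/annP.
have symD (S S1 S2 : T) : decomposition S S1 S2 -> decomposition S S2 S1.
  move=> [SE [annS dirS] dL dM]; split.
  - by rewrite capvC.
  - split; first by rewrite addvC.
    by apply/directv_addP; rewrite capvC; apply/directv_addP.
  - by move=> i /dL[]; [right | left].
  - by move=> i /dM[]; [right | left].
move=> S S1 S2 dec _ _.
case chiS: (chi S); last by left; rewrite (muU _ _ _ dec chiS).
case chi1: (chi S1); first by left.
case chi2: (chi S2); first by right.
have [/eqP S10 [B1 SB1]] := (chi_Mu S1).1 chi1.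
have [/eqP S20 [B2 SB2]] := (chi_Mu S2).1 chi2.
have [SE _ decL _] := dec.
have [S0|nB] := (chi_Lambda S).1 chiS; last first.
  by case: (nB (B1 :|: B2)); rewrite SE SB1 SB2 interM_setU.
have SL : (S <= lker (L ord0))%VS by rewrite S0 sub0v.
have [] := decL ord0 SL.
  by rewrite SB1 (negPf (interM_notin_L0 _ _)) // -SB1.
by rewrite SB2 (negPf (interM_notin_L0 _ _)) // -SB2.
Qed.

Hypothesis word_first : nth 0%N (multizeta_word ns) 0 = 1%N.
Hypothesis word_last : nth 0%N (multizeta_word ns) n.-1 = 0%N.

Definition unit_chain p : V := of_chain ns (fun q => (q == p)%:R).

Lemma chain_unit p q : (0 < p)%N -> (q <= n.+1)%N ->
  chain (unit_chain p) q = (q == p)%:R.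
Proof. by move=> p0 qn; rewrite of_chainK // eq_sym (gtn_eqF p0). Qed.

Lemma L_unit (i k : 'I_n.+1) : (k != 0%N :> nat) ->
  L i (unit_chain k) = (i == k)%:R.
Proof.
move=> k0; have kn := ltn_ord k; have in1 := ltn_ord i.
rewrite multizeta_LE // !chain_unit ?lt0n // 1?ltnW // (gtn_eqF kn).
by case: eqP => [i0|_]; rewrite ?mulr0 ?subr0 // -val_eqE /= i0 eq_sym (negPf k0).
Qed.

Lemma L_neq0 i : L i != 0.
Proof.
have [i0|i0] := eqVneq (i : nat) 0%N.
  apply/eqP => /(congr1 (fun f : 'Hom(V, K^o) => f (step K ns 0))).
  by rewrite multizeta_LE // i0 chain_step // lfunE => /eqP; rewrite oner_eq0.
apply/eqP => /(congr1 (fun f : 'Hom(V, K^o) => f (unit_chain i))).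
by rewrite L_unit // eqxx lfunE => /eqP; rewrite oner_eq0.
Qed.

Lemma M_neq0 j : M j != 0.
Proof.
apply/eqP => /(congr1 (fun f : 'Hom(V, K^o) => f (step K ns j))) /eqP.
by rewrite lfunE M_step // eqxx.
Qed.

(** A unit vector at a place compared by M_j, other than i, is in L_i and not in M_j. Such a place
    among 1, ..., n is missing only for M_0 against L_1 and M_n against L_n; these are separated by
    a_1 = 1 and a_n = 0. *)
Lemma lker_L_not_sub_M i j : ~~ (lker (L i) <= lker (M j))%VS.
Proof.
suff [v Li Mj] : exists2 v, L i v = 0 & M j v <> 0.
  by apply/subvPn; exists v; rewrite memv_ker ?Li //; apply/eqP.
have jn := ltn_ord j; have in1 := ltn_ord i.
have unitP p : (0 < p <= n)%N -> p != i -> (p == j) || (p == j.+1) ->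
    exists2 v, L i v = 0 & M j v <> 0.
  move=> /andP[p0 pn] pi pj; exists (unit_chain p).
    have := @L_unit i (inord p); rewrite inordK // -lt0n => /(_ p0) ->.
    by rewrite -val_eqE /= inordK // eq_sym (negPf pi).
  move=> /(multizeta_M_eq0 n_gt0); rewrite !chain_unit // 1?ltnW //.
  case/orP: pj => /eqP->; first by rewrite eqxx gtn_eqF // => /eqP; rewrite oner_eq0.
  by rewrite eqxx ltn_eqF // => /eqP; rewrite eq_sym oner_eq0.
have [j0|j0] := eqVneq (j : nat) 0%N.
  have [i1|i1] := eqVneq (i : nat) 1%N; last by apply: (unitP 1%N); rewrite ?j0 // eq_sym.
  exists (of_chain ns (fun q => ((q == 1%N) || (q == n.+1))%:R)).
    by rewrite multizeta_LE // i1 !of_chainK //= eqxx orbT word_first mulr1 subrr.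
  move=> /(multizeta_M_eq0 n_gt0); rewrite j0 chain0 of_chainK //= => /eqP.
  by rewrite eq_sym oner_eq0.
have [jn'|j'n] := eqVneq (j : nat) n.
  have [i_n|i_n] := eqVneq (i : nat) n; last by apply: (unitP n);
    rewrite ?jn' ?n_gt0 ?leqnn ?eqxx // eq_sym.
  exists (unit_chain n.+1).
    rewrite multizeta_LE // i_n (gtn_eqF n_gt0) !chain_unit // (ltn_eqF (ltnSn n)).
    by rewrite word_last mul0r subrr.
  move=> /(multizeta_M_eq0 n_gt0); rewrite jn' !chain_unit // eqxx (ltn_eqF (ltnSn n)).
  by move/eqP; rewrite eq_sym oner_eq0.
have [ij|ij] := eqVneq (i : nat) j.
  by apply: (unitP j.+1); rewrite ?eqxx ?orbT ?ij //; lia.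
by apply: (unitP (j : nat)); rewrite ?eqxx // 1?eq_sym //; lia.
Qed.

Lemma multizeta_bi_arrangement : is_bi_arrangement L M chi.
Proof.
have Linj (i k : 'I_n.+1) : (k != 0%N :> nat) -> lker (L i) = lker (L k) -> i = k.
  move=> k0 ik; apply/eqP; apply: contraT => nik.
  have : unit_chain k \in lker (L k) by rewrite -ik memv_ker L_unit // (negPf nik).
  by rewrite memv_ker L_unit // eqxx oner_eq0.
split; last exact: multizeta_kunneth.
- by split; [exact: L_neq0 | exact: M_neq0].
- split=> [i k /= ik|j k /= jk|i j ij].
  + have [k0|] := eqVneq (k : nat) 0%N; last by move/Linj; apply.
    have [i0|] := eqVneq (i : nat) 0%N; first by apply/val_inj; rewrite /= i0 k0.
    by move=> i0; apply/esym/Linj.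
  + apply/eqP; apply: contraT => njk.
    have : step K ns j \in lker (M j).
      by rewrite jk memv_ker M_step // eq_sym.
    by rewrite memv_ker M_step // eqxx.
  + by have := lker_L_not_sub_M i j; rewrite ij subvv.
- move=> i; apply/chi_Lambda; right=> B iB.
  have [B0|[j jB]] := set_0Vmem B.
    case/eqP: (L_neq0 i); apply/lfunP => v; rewrite lfunE /=; apply/eqP.
    by rewrite -memv_ker iB B0 /interM big_set0 memvf.
  have := lker_L_not_sub_M i j; rewrite iB => /negP[]; apply/sub_lkerP => v.
  by move/interMP; apply.
- move=> j; apply/chi_Mu; split; last by exists [set j]; rewrite /interM big_set1.
  have [k kj] : exists k : 'I_n.+1, k != j.
    have [->|] := eqVneq j ord0; last by exists ord0; rewrite eq_sym.
    by exists ord_max; rewrite -val_eqE /= -lt0n.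
  move=> Mj0; have : step K ns k \in lker (M j) by rewrite memv_ker M_step // eq_sym.
  by rewrite Mj0 memv0 (negPf (step_neq0 K n_gt0 k)).
Qed.

(** For color lambda, the intersection of a circuit containing i lies between S and L_i, so it has
    color lambda. For color mu, [splits_circuit] applies to the intersection of the circuit. *)
Lemma multizeta_tame : tame L M chi.
Proof.
move=> S sS; case chiS: (chi S); [left | right]; split=> //.
  have [i [Si iS]] : exists i, lambda_hyperplane chi S i.
    have [S0|S0] := eqVneq (stratum_space S) 0%VS.
      by exists ord0; apply: lambda_hyperplane0.
    have [i [v [iS _ _]]] := lambda_hyperplane_ex (elimN eqP S0) chiS.
    by exists i.
  exists i => // A B _ SAB chiAB; apply/negP => iA.
  have : chi (inter L M A B) = Lambda; last by rewrite chiAB.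
  apply: (iS (SeqSub (inter_in L M A B)) SAB); apply/sub_lkerP => v.
  by rewrite memv_cap => /andP[/interLP vA _]; apply: vA.
have [j [Sj jS]] := mu_splitting_ex n_gt0 sS chiS.
exists j => // A B cAB SAB chiAB; apply/negP => jB.
pose Q : T := SeqSub (inter_in L M A B).
have Qj : (Q <= lker (M j))%VS.
  by apply/sub_lkerP => v /memv_capP[_ /interMP]; apply.
have [i [tau [[Qi _] sQ iE jE]]] := jS Q SAB Qj chiAB.
have : j \notin B; last by rewrite jB.
exact: (splits_circuit sQ Qi (L_neq0 i) (M_neq0 j) iE jE cAB).
Qed.

Lemma multizeta_exact : exact L M chi.
Proof.
apply: exact_criterion; [exact: L_neq0 | exact: M_neq0 | |].
  move=> S sS chiS; have [S0|S0] := eqVneq (stratum_space S) 0%VS.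
    by exists ord0; apply: lambda_hyperplane0.
  have [i [v [iS _ _]]] := lambda_hyperplane_ex (elimN eqP S0) chiS.
  by exists i.
move=> S sS chiS; have [j [Sj jS]] := mu_splitting_ex n_gt0 sS chiS.
exists j => // Q SQ Qj; case chiQ: (chi Q); [right | by left].
have [i [tau [iQ sQ iE jE]]] := jS Q SQ Qj chiQ; exists i; split=> //.
- by case: iQ => Qi _; apply: (splits_cover sQ Qi Qj iE jE).
- exact: (splits_cap sQ iE jE).
Qed.

End MultizetaTame.

(** * The word (a_1, ..., a_n), and the theorem *)

Lemma multizeta_word_size ns : all (leq 1) ns ->
  size (multizeta_word ns) = sumn ns.
Proof.
elim: ns => // m ns IH /= /andP[m0 /IH ns0].
by rewrite /multizeta_word /= -/(multizeta_word ns) size_cat size_nseq ns0; lia.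
Qed.

Lemma multizeta_word_first ns : (1 <= size ns)%N ->
  nth 0%N (multizeta_word ns) 0 = 1%N.
Proof. by case: ns. Qed.

(** The word ends with its last block 1, 0, ..., 0, which contains a zero because its length is at
    least 2. *)
Lemma multizeta_word_last ns : all (leq 1) ns -> (2 <= last 0%N ns)%N ->
  nth 0%N (multizeta_word ns) (sumn ns).-1 = 0%N.
Proof.
move=> ns1 l2; rewrite -(multizeta_word_size ns1) nth_last.
case/lastP: ns l2 {ns1} => // ns m; rewrite last_rcons => m2.
rewrite /multizeta_word map_rcons flatten_rcons last_cat /=.
by case: m m2 => [|[|m]] // _; elim: m => //= m; case: m.
Qed.

Theorem proposition5p7 (R : realType) (ns : seq nat)
  (r_ge1 : (1 <= size ns)%N)
  (ns_ge1 : forall k : nat, (k.+1 < size ns)%N -> (1 <= nth 0%N ns k)%N)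
  (nr_ge2 : (2 <= last 0%N ns)%N) :
  lambda_tame (multizeta_L R[i] ns) (multizeta_M R[i] ns)
              (multizeta_color R[i] ns) /\
  lambda_exact (multizeta_L R[i] ns) (multizeta_M R[i] ns)
               (multizeta_color R[i] ns).
Proof.
have ns1 : all (leq 1) ns.
  apply/(all_nthP 0%N) => k kn; have [k1|] := ltnP k.+1 (size ns).
    exact: ns_ge1.
  move=> nk; have -> : k = (size ns).-1 by lia.
  by rewrite nth_last ltnW.
have n_gt0 : (0 < sumn ns)%N.
  by rewrite -(multizeta_word_size ns1); case: (ns) r_ge1.
have w1 := multizeta_word_first r_ge1.
have wn := multizeta_word_last ns1 nr_ge2.
have arr := multizeta_bi_arrangement R[i] n_gt0 w1 wn.
split; split=> //.
- exact: multizeta_tame n_gt0.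
- exact: multizeta_exact n_gt0.
Qed.
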